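(* For all terms $t,s\in\mathbb T$ and all $\varepsilon\in\mathbb Q_{\ge0}$: if $\vdash t\equiv_\varepsilon s$ (derivable from the empty set of hypotheses), then $\mathbf d(t,s)\le\varepsilon$.
   Context: Fix a countable set $\mathcal L$ of labels and a countable set $\mathcal X$ of names. $\mathcal D(S)$ is the set of finitely supported sub-probability distributions on $S$; $\mu(E)=\sum_{x\in E}\mu(x)$; $\mathbb 1_E$ is the indicator function of $E$. Terms: given a set $V$ of constants, $\mathbb T(V)$ is the set of terms generated by: each $v\in V$ and each name $X\in\mathcal X$ is a term; if $t,s$ are terms, $a\in\mathcal L$, $e\in[0,1]$, $X\in\mathcal X$, then $a.t$, $t+_e s$ and $\mu X.t$ are terms, where $\mu X$ binds $X$. Terms are identified up to renaming of bound names; $t[s/X]$ is capture-avoiding substitution for free occurrences of $X$. $\mathbb T=\mathbb T(\emptyset)$. A name $X$ is guarded in $t$ if every free occurrence of $X$ in $t$ lies inside a subterm $a.u$, or inside the right argument $u$ of a subterm $s+_1u$, or inside the left argument $u$ of a subterm $u+_0 s$. Universal chain: $\tau_{\mathbb T}$ is the least function $\mathbb T\to[(\mathcal L\times\mathbb T)\uplus\mathcal X\to[0,1]]$ (pointwise order) such that $\tau_{\mathbb T}(X)=\mathbb 1_{\{X\}}$, $\tau_{\mathbb T}(a.t)=\mathbb 1_{\{(a,t)\}}$, $\tau_{\mathbb T}(t+_e s)=e\,\tau_{\mathbb T}(t)+(1-e)\,\tau_{\mathbb T}(s)$, $\tau_{\mathbb T}(\mu X.t)=\tau_{\mathbb T}(t[\mu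 X.t/X])$; each $\tau_{\mathbb T}(t)$ lies in $\mathcal D((\mathcal L\times\mathbb T)\uplus\mathcal X)$. Distance: for a set $A$ with $1$-bounded pseudometric $\delta$ and finitely supported probability distributions $\mu,\nu$ on $A$, $K_\delta(\mu,\nu)=\min\{\sum_{x,y}\delta(x,y)\omega(x,y):\omega\text{ a coupling of }\mu,\nu\}$; for a sub-probability $\mu$, $\mu^*$ extends it to $A\uplus\{\bot\}$ with $\mu^*(\bot)=1-\mu(A)$. For a $1$-bounded pseudometric $d$ on $\mathbb T$, $\Lambda(d)$ is the greatest $1$-bounded pseudometric on $((\mathcal L\times\mathbb T)\uplus\mathcal X)\uplus\{\bot\}$ with $\Lambda(d)((a,t),(a,s))=d(t,s)$; $\Psi(d)(t,s)=K_{\Lambda(d)}(\tau_{\mathbb T}(t)^*,\tau_{\mathbb T}(s)^* )$; $\mathbf d$ is the least fixed point of $\Psi$ among $1$-bounded pseudometrics on $\mathbb T$ ordered pointwise (the probabilistic bisimilarity distance). Deduction system: let $W$ be a countable set of metavariables. A quantitative equation is $t\equiv_\varepsilon s$ with $t,s\in\mathbb T(W)$ and $\varepsilon\in\mathbb Q_{\ge0}$. A substitution $\sigma$ maps metavariables to terms of $\mathbb T(W)$ and is extended homomorphically; $\sigma(\Gamma)$ applies it to every equation in $\Gamma$. $\vdash$ is the smallest relation between sets of quantitative equations and quantitative equations (write $\Gamma\vdash\varphi$; $\vdash\varphi$ for $\emptyset\vdash\varphi$; $\Gamma\vdash\Theta$ means $\Gamma\vdash\varphi$ for all $\varphi\in\Theta$)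 satisfying, for all terms $t,s,u,t',s'$ of $\mathbb T(W)$, names $X$, labels $a$, $e\in[0,1]$ and rationals $\varepsilon,\varepsilon'\ge0$: (Refl) $\vdash t\equiv_0 t$; (Symm) $\{t\equiv_\varepsilon s\}\vdash s\equiv_\varepsilon t$; (Triang) $\{t\equiv_\varepsilon u,u\equiv_{\varepsilon'}s\}\vdash t\equiv_{\varepsilon+\varepsilon'}s$; (Max) $\{t\equiv_\varepsilon s\}\vdash t\equiv_{\varepsilon+\varepsilon'}s$ for $\varepsilon'>0$; (Arch) $\{t\equiv_{\varepsilon'}s\mid\varepsilon'>\varepsilon\}\vdash t\equiv_\varepsilon s$; (Subst) if $\Gamma\vdash t\equiv_\varepsilon s$ then $\sigma(\Gamma)\vdash\sigma(t)\equiv_\varepsilon\sigma(s)$; (Cut) if $\Gamma\vdash\Theta$ and $\Theta\vdash t\equiv_\varepsilon s$ then $\Gamma\vdash t\equiv_\varepsilon s$; (Assum) if $t\equiv_\varepsilon s\in\Gamma$ then $\Gamma\vdash t\equiv_\varepsilon s$; (B1) $\vdash t+_1s\equiv_0t$; (B2) $\vdash t+_et\equiv_0t$; (SC) $\vdash t+_es\equiv_0s+_{1-e}t$; (SA) $\vdash(t+_es)+_{e'}u\equiv_0t+_{ee'}(s+_{\frac{e'-ee'}{1-ee'}}u)$ for $e,e'\in[0,1)$; (Unfold) $\vdash\mu X.t\equiv_0t[\mu X.t/X]$; (Unguard) $\vdash\mu X.(t+_eX)\equiv_0\mu X.t$; (Fix) $\{s\equiv_0t[s/X]\}\vdash s\equiv_0\mu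 X.t$ whenever $X$ is guarded in $t$; (Cong) $\{t\equiv_0s\}\vdash\mu X.t\equiv_0\mu X.s$; (Top) $\vdash t\equiv_1s$; (Pref) $\{t\equiv_\varepsilon s\}\vdash a.t\equiv_\varepsilon a.s$; (IB) $\{t\equiv_\varepsilon s,t'\equiv_{\varepsilon'}s'\}\vdash t+_et'\equiv_{\varepsilon''}s+_es'$ for every rational $\varepsilon''\ge e\varepsilon+(1-e)\varepsilon'$.
   Formalization: (Unguard) is required only for e≠0, since at e=0 it equates μX.(a.X +_0 X) with μX.a.X, at distance 1; (Subst) allows only terms without free names, since with (Cong) open terms give X ≡_0 μX.X, also at distance 1; the set of names is taken infinite. *)

(* Defs.v *)
From HB Require Import structures.
From mathcomp Require Import all_boot all_order all_algebra.
From mathcomp Require Import interval_inference.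
From mathcomp Require Import boolp classical_sets functions cardinality fsbigop.
From mathcomp Require Import reals numfun.

Set Implicit Arguments.
Unset Strict Implicit.
Unset Printing Implicit Defensive.

Import Order.TTheory GRing.Theory Num.Theory.

Local Open Scope classical_set_scope.
Local Open Scope ring_scope.

(* Terms up to renaming of bound names, as well-scoped de Bruijn terms:
   [N] is the type of the names that may occur free, and in [Mu b] the name
   bound by this binder is [None].  At [N := X] these are exactly the terms of
   T(V) modulo alpha-equivalence when the set [X] of names is infinite; the
   named binder "mu X. t" is [mu] below. *)
Inductive term (R : realType) (L V N : Type) : Type :=
| Meta of V
| Name of N
| Pref of L & term R L V N
| Choice of {i01 R} & term R L V N & term R L V N
| Mu of term R L V (option N).

Arguments Meta {R L V N} _.
Arguments Name {R L V N} _.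
Arguments Pref {R L V N} _ _.
Arguments Choice {R L V N} _ _ _.
Arguments Mu {R L V N} _.

HB.instance Definition _ R L V N := gen_eqMixin (term R L V N).
HB.instance Definition _ R L V N := gen_choiceMixin (term R L V N).

Section Syntax.
Variables (R : realType) (L V : Type).
Local Notation term := (@term R L).

Fixpoint rename (N M : Type) (f : N -> M) (t : term V N) : term V M :=
  match t with
  | Meta v => Meta v
  | Name x => Name (f x)
  | Pref a u => Pref a (rename f u)
  | Choice e u w => Choice e (rename f u) (rename f w)
  | Mu b => Mu (rename (omap f) b)
  end.

Fixpoint bind (N M : Type) (f : N -> term V M) (t : term V N) : term V M :=
  match t with
  | Meta v => Meta v
  | Name x => f x
  | Pref a u => Pref a (bind f u)
  | Choice e u w => Choice e (bind f u) (bind f w)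
  | Mu b => Mu (bind (fun o => if o is Some x then rename Some (f x)
                               else Name None) b)
  end.

Fixpoint embed (N : Type) (t : term void N) : term V N :=
  match t with
  | Meta v => match v with end
  | Name x => Name x
  | Pref a u => Pref a (embed u)
  | Choice e u w => Choice e (embed u) (embed w)
  | Mu b => Mu (embed b)
  end.

(* In "u +_e w" with e = 0 (resp. e = 1) every occurrence in the left
   argument u (resp. the right argument w) counts as guarded. *)
Fixpoint guarded (N : Type) (x : N) (t : term V N) : Prop :=
  match t with
  | Meta _ => True
  | Name y => y <> x
  | Pref _ _ => True
  | Choice e u w => (e%:num = 0 \/ guarded x u) /\ (e%:num = 1 \/ guarded x w)
  | Mu b => guarded (Some x) b
  end.

Definition mu (X : eqType) (x : X) (t : term V X) : term V X :=
  Mu (rename (fun y => if y == x then None else Some y) t).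

Definition subst (X : eqType) (t : term V X) (s : term V X) (x : X) :
    term V X :=
  bind (fun y => if y == x then s else Name y) t.

End Syntax.

Section Order.
Variables (R : realType) (A B : Type).

(* Pointwise order; [least P] and [greatest P] are the least and greatest
   elements of [P] (the constant 1 if there is none). *)
Definition is_least (P : set (A -> B -> R)) (f : A -> B -> R) : Prop :=
  P f /\ forall g, P g -> forall a b, f a b <= g a b.

Definition is_greatest (P : set (A -> B -> R)) (f : A -> B -> R) : Prop :=
  P f /\ forall g, P g -> forall a b, g a b <= f a b.

Definition least (P : set (A -> B -> R)) : A -> B -> R :=
  xget (fun _ _ => 1) (is_least P).

Definition greatest (P : set (A -> B -> R)) : A -> B -> R :=
  xget (fun _ _ => 1) (is_greatest P).

End Order.

Section Kantorovich.
Variables (R : realType).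

Definition pseudometric1 (A : Type) (m : A -> A -> R) : Prop :=
  [/\ forall x y, 0 <= m x y <= 1,
      forall x, m x x = 0,
      forall x y, m x y = m y x
    & forall x y z, m x z <= m x y + m y z].

Definition is_fdist (A : choiceType) (p : A -> R) : Prop :=
  [/\ forall x, 0 <= p x,
      finite_set [set x | p x != 0]
    & \sum_(x \in [set: A]) p x = 1].

Definition is_coupling (A : choiceType) (p q : A -> R) (w : A * A -> R) :
    Prop :=
  [/\ is_fdist w,
      forall x, \sum_(y \in [set: A]) w (x, y) = p x
    & forall y, \sum_(x \in [set: A]) w (x, y) = q y].

(* The infimum is a minimum when p and q are finitely supported probability
   distributions: their couplings form a nonempty compact polytope. *)
Definition kantorovich (A : choiceType) (m : A -> A -> R) (p q : A -> R) : R :=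
  inf [set \sum_(z \in [set: A * A]) m z.1 z.2 * w z | w in is_coupling p q].

(* [None] is the extra point bottom. *)
Definition star (A : choiceType) (p : A -> R) (o : option A) : R :=
  if o is Some x then p x else 1 - \sum_(x \in [set: A]) p x.

End Kantorovich.

Section Distance.
Variables (R : realType) (L X : countType).

Local Notation gterm := (term R L void X).
Local Notation obs := (L * gterm + X)%type.

Definition chain_eqs (tau : gterm -> obs -> R) : Prop :=
  [/\ forall t o, 0 <= tau t o <= 1,
      forall x, tau (Name x) = \1_[set inr x],
      forall a t, tau (Pref a t) = \1_[set inl (a, t)],
      forall e t s o,
        tau (Choice e t s) o = e%:num * tau t o + (1 - e%:num) * tau s o
    & forall x t, tau (mu x t) = tau (subst t (mu x t) x)].

Definition universal_chain : gterm -> obs -> R := least chain_eqs.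

Definition lift_dist (d : gterm -> gterm -> R) :
    option obs -> option obs -> R :=
  greatest [set m | pseudometric1 m /\
    forall a t s, m (Some (inl (a, t))) (Some (inl (a, s))) = d t s].

Definition Psi (d : gterm -> gterm -> R) (t s : gterm) : R :=
  kantorovich (lift_dist d)
    (star (universal_chain t)) (star (universal_chain s)).

Definition bisim_dist : gterm -> gterm -> R :=
  least [set d | pseudometric1 d /\ Psi d = d].

End Distance.

Section Deduction.
Variables (R : realType) (L X W : countType).
Local Notation mterm := (term R L W X).

Record qeq : Type := QEq { lhs : mterm; rhs : mterm; tol : {nonneg rat} }.

Local Notation "t ≡_[ e ] s" := (QEq t s e) (at level 70, e at level 200).

(* The homomorphic extensions of a substitution [sigma] on metavariables.
   Since terms are taken up to renaming, mu X. v = mu Y. v for a metavariable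
   v, so an extension that commutes with every mu X exists only if no
   [sigma v] has a free name.  Instantiating v by an open term would be
   incompatible with (Cong), which yields {v ≡_0 X} |- mu X. v ≡_0 mu X. X:
   with v := X this would give |- X ≡_0 mu X. X, two terms at distance 1. *)
Definition hom_extension (sigma : W -> mterm) (h : mterm -> mterm) : Prop :=
  [/\ forall v, h (Meta v) = sigma v,
      forall x, h (Name x) = Name x,
      forall a t, h (Pref a t) = Pref a (h t),
      forall e t s, h (Choice e t s) = Choice e (h t) (h s)
    & forall x t, h (mu x t) = mu x (h t)].

Definition map_qeq (h : mterm -> mterm) (phi : qeq) : qeq :=
  h (lhs phi) ≡_[tol phi] h (rhs phi).

Inductive derivable : set qeq -> qeq -> Prop :=
| D_Refl t :
    derivable set0 (t ≡_[0%:nng] t)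
| D_Symm t s eps :
    derivable [set (t ≡_[eps] s)] (s ≡_[eps] t)
| D_Triang t u s eps eps' :
    derivable [set (t ≡_[eps] u); (u ≡_[eps'] s)]
              (t ≡_[(eps%:num + eps'%:num)%:nng] s)
| D_Max t s eps (eps' : {nonneg rat}) : 0 < eps'%:num ->
    derivable [set (t ≡_[eps] s)] (t ≡_[(eps%:num + eps'%:num)%:nng] s)
| D_Arch t s (eps : {nonneg rat}) :
    derivable [set (t ≡_[eps'] s) | eps' in [set e | eps%:num < e%:num]]
              (t ≡_[eps] s)
| D_Subst Gamma phi sigma h : hom_extension sigma h ->
    derivable Gamma phi ->
    derivable (map_qeq h @` Gamma) (map_qeq h phi)
| D_Cut Gamma Theta phi :
    (forall psi, Theta psi -> derivable Gamma psi) ->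
    derivable Theta phi -> derivable Gamma phi
| D_Assum Gamma phi : Gamma phi -> derivable Gamma phi
| D_B1 t s :
    derivable set0 (Choice 1%:i01 t s ≡_[0%:nng] t)
| D_B2 e t :
    derivable set0 (Choice e t t ≡_[0%:nng] t)
| D_SC e t s :
    derivable set0 (Choice e t s ≡_[0%:nng] Choice (1 - e%:num)%:i01 s t)
| D_SA (e e' e'' : {i01 R}) t s u :
    e%:num < 1 -> e'%:num < 1 ->
    e''%:num = (e'%:num - e%:num * e'%:num) / (1 - e%:num * e'%:num) ->
    derivable set0 (Choice e' (Choice e t s) u
      ≡_[0%:nng] Choice (e%:num * e'%:num)%:i01 t (Choice e'' s u))
| D_Unfold x t :
    derivable set0 (mu x t ≡_[0%:nng] subst t (mu x t) x)
(* The rule fails for e = 0: a.X +_0 X behaves as X, but mu X. X and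
   mu X. a.X are at distance 1. *)
| D_Unguard x (e : {i01 R}) t : e%:num != 0 ->
    derivable set0 (mu x (Choice e t (Name x)) ≡_[0%:nng] mu x t)
| D_Fix x t s : guarded x t ->
    derivable [set (s ≡_[0%:nng] subst t s x)] (s ≡_[0%:nng] mu x t)
| D_Cong x t s :
    derivable [set (t ≡_[0%:nng] s)] (mu x t ≡_[0%:nng] mu x s)
| D_Top t s :
    derivable set0 (t ≡_[1%:nng] s)
| D_Pref a t s eps :
    derivable [set (t ≡_[eps] s)] (Pref a t ≡_[eps] Pref a s)
| D_IB (e : {i01 R}) t s t' s' (eps eps' eps'' : {nonneg rat}) :
    e%:num * ratr eps%:num + (1 - e%:num) * ratr eps'%:num
      <= ratr eps''%:num ->
    derivable [set (t ≡_[eps] s); (t' ≡_[eps'] s')]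
              (Choice e t t' ≡_[eps''] Choice e s s').

End Deduction.

(* Main.v *)
(* Sub-probability measures on observations are handled through the expectations
   Ev t f, computed by recursion on t. Bisimilarity, i.e. distance 0, is the
   largest equivalence ~ on terms such that t ~ s implies Ev t f = Ev s f for
   all f invariant under ~. Since Ev (t[r]) f is the expectation under t of the
   pullback of f along r, bisimilarity is preserved by substitution, and the
   rules for recursion (Unguard), (Fix), (Cong) follow by a bisimulation up-to
   argument on the pairs (u[T/x], u[T'/x]). The quantitative rules follow from
   the corresponding inequalities for couplings. Derivations are interpreted
   under all instantiations of the metavariables by closed terms: as there are
   infinitely many names, every homomorphic extension is of this form. *)
From HB Require Import structures.
Require Import Defs.
From mathcomp Require Import all_boot all_order all_algebra.
From mathcomp Require Import interval_inference boolp classical_sets cardinality.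
From mathcomp Require Import functions fsbigop reals numfun.
From mathcomp Require Import ring lra zify.
(* The constructor [Choice] is shadowed by the MathComp module of that name. *)
Import Defs.

Set Implicit Arguments.
Unset Strict Implicit.
Unset Printing Implicit Defensive.

Import Order.TTheory GRing.Theory Num.Theory.

Local Open Scope ring_scope.

(** * Renaming, substitution and named binders *)

Section Substitution.
Variables (R : realType) (L V : Type).
Implicit Types N M P : Type.
Local Notation term := (@term R L).

(** All rules about recursion have tolerance 0, so binders are studied only up to bisimilarity and
    the quantitative inequalities never involve them. The obstacle is that [universal_chain] and
    [bisim_dist] are selected by extremality, with a default value when no extremum exists, so
    existence has to be shown for both. For the chain, an arbitrary solution is compared with [Ev]
    by induction on open terms: unfolding a binder does not make the term smaller, so the induction
    keeps the bound name free and the recursive term enters only as the value of that name. For the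
    distance, an equivalence is read as a pseudometric with values 0 and 1; being a bisimulation
    makes it a prefixed point of [Psi], hence an upper bound of the distance. The opposite passage,
    from distance 0 to equal expectations, rests on invariant functions being Lipschitz on a finite
    support. *)

Definition up N M (f : N -> term V M) (o : option N) : term V (option M) :=
  if o is Some x then rename Some (f x) else Name None.

Definition inst1 N (s : term V N) (o : option N) : term V N :=
  if o is Some x then Name x else s.

Lemma bind_Mu N M (f : N -> term V M) b : bind f (Mu b) = Mu (bind (up f) b).
Proof. by []. Qed.

Lemma rename_bindE N M (f : N -> M) (t : term V N) :
  rename f t = bind (fun x => Name (f x)) t.
Proof.
elim: t M f => {N} [N v|N x|N a u IHu|N e u IHu w IHw|N b IHb] M f //=.
- by rewrite IHu.
- by rewrite IHu IHw.
- by rewrite IHb; congr (Mu (bind _ _)); apply/funext => -[].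
Qed.

Lemma bind_rename N M P (f : M -> term V P) (g : N -> M) (t : term V N) :
  bind f (rename g t) = bind (fun x => f (g x)) t.
Proof.
elim: t M P f g => {N} [N v|N x|N a u IHu|N e u IHu w IHw|N b IHb] M P f g //=.
- by rewrite IHu.
- by rewrite IHu IHw.
- by rewrite IHb; congr (Mu (bind _ _)); apply/funext => -[].
Qed.

Lemma rename_comp N M P (f : M -> P) (g : N -> M) (t : term V N) :
  rename f (rename g t) = rename (fun x => f (g x)) t.
Proof. by rewrite rename_bindE bind_rename -rename_bindE. Qed.

Lemma rename_bind N M P (g : M -> P) (f : N -> term V M) (t : term V N) :
  rename g (bind f t) = bind (fun x => rename g (f x)) t.
Proof.
elim: t M P f g => {N} [N v|N x|N a u IHu|N e u IHu w IHw|N b IHb] M P f g //=.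
- by rewrite IHu.
- by rewrite IHu IHw.
- rewrite IHb; congr (Mu (bind _ _)); apply/funext => -[x|] //=.
  by rewrite !rename_comp.
Qed.

Lemma bind_bind N M P (g : M -> term V P) (f : N -> term V M) (t : term V N) :
  bind g (bind f t) = bind (fun x => bind g (f x)) t.
Proof.
elim: t M P f g => {N} [N v|N x|N a u IHu|N e u IHu w IHw|N b IHb] M P f g //=.
- by rewrite IHu.
- by rewrite IHu IHw.
- rewrite IHb; congr (Mu (bind _ _)); apply/funext => -[x|] //=.
  by rewrite bind_rename rename_bind.
Qed.

Lemma bind_Name N (t : term V N) : bind Name t = t.
Proof.
elim: t => {N} [N v|N x|N a u IHu|N e u IHu w IHw|N b IHb] //=.
- by rewrite IHu.
- by rewrite IHu IHw.
- by rewrite -[in RHS]IHb; congr (Mu (bind _ _)); apply/funext => -[].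
Qed.

Lemma rename_id N (t : term V N) : rename id t = t.
Proof. by rewrite rename_bindE bind_Name. Qed.

Lemma bind_inst1 N M (f : N -> term V M) (s : term V N) (u : term V (option N)) :
  bind f (bind (inst1 s) u) = bind (inst1 (bind f s)) (bind (up f) u).
Proof.
rewrite !bind_bind; congr bind; apply/funext => -[x|] //=.
by rewrite bind_rename bind_Name.
Qed.

Lemma bind_inst1_up N M (f : N -> term V M) (s : term V M) (u : term V (option N)) :
  bind (inst1 s) (bind (up f) u) = bind (fun o => if o is Some x then f x else s) u.
Proof.
rewrite !bind_bind; congr bind; apply/funext => -[x|] //=.
by rewrite bind_rename bind_Name.
Qed.

Fixpoint occurs N (x : N) (t : term V N) : Prop :=
  match t with
  | Meta _ => False
  | Name y => y = x
  | Pref _ u => occurs x u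
  | Choice _ u w => occurs x u \/ occurs x w
  | Mu b => occurs (Some x) b
  end.

Lemma eq_rename_occurs N M (f g : N -> M) (t : term V N) (x : N) :
  rename f t = rename g t -> occurs x t -> f x = g x.
Proof.
elim: t M f g x => {N} [N v|N y|N a u IHu|N e u IHu w IHw|N b IHb] M f g x //=.
- by move=> [] + <-.
- by move=> [] /IHu; apply.
- by move=> [] /IHu + /IHw + []; [move=> + _; apply|move=> _; apply].
- by move=> [] /IHb /[apply] -[].
Qed.

Lemma occurs_eq_rename N M (f g : N -> M) (t : term V N) :
  (forall x, occurs x t -> f x = g x) -> rename f t = rename g t.
Proof.
elim: t M f g => {N} [N v|N y|N a u IHu|N e u IHu w IHw|N b IHb] M f g //= fg.
- by rewrite fg.
- by rewrite (IHu _ f g).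
- by rewrite (IHu _ f g) ?(IHw _ f g) // => x xo; apply: fg; [right|left].
- by rewrite (IHb _ (omap f) (omap g)) // => -[x|] //= /fg ->.
Qed.

(** For [g := of_void X] the hypothesis says that no name occurs, and the preimage is a closed
    term. *)
Lemma rename_preimage N M (g : M -> N) (t : term V N) :
  (forall x, occurs x t -> exists y, g y = x) -> exists c, t = rename g c.
Proof.
elim: t M g => {N} [N v|N y|N a u IHu|N e u IHu w IHw|N b IHb] M g //= tg.
- by exists (Meta v).
- by have [z <-] := tg _ erefl; exists (Name z).
- by have [c ->] := IHu _ _ tg; exists (Pref a c).
- have [c ->] := IHu _ g (fun x xo => tg x (or_introl xo)).
  have [c' ->] := IHw _ g (fun x xo => tg x (or_intror xo)).
  by exists (Choice e c c').
- have [|c ->] := IHb _ (omap g); last by exists (Mu c).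
  move=> [x /tg [y <-]|_]; first by exists (Some y).
  by exists None.
Qed.

Lemma finite_occurs N (t : term V N) : finite_set [set x | occurs x t]%classic.
Proof.
elim: t => {N} [N v|N y|N a u IHu|N e u IHu w IHw|N b IHb] //=.
- by apply: sub_finite_set (finite_set1 y) => x /= ->.
- apply: sub_finite_set (_ : finite_set
    ([set x | occurs x u] `|` [set x | occurs x w])%classic) => //.
  by rewrite finite_setU.
- apply: (@finite_preimage _ _ [set o | occurs o b]%classic Some) => // x y _ _ [].
Qed.

End Substitution.

(** * Named binders versus de Bruijn binders *)

Section NamedBinder.
Variables (R : realType) (L V : Type) (X : eqType).
Local Notation term := (@term R L).

(** The renaming inside [mu]: [mu x t] is [Mu (rename (close x) t)] by conversion. *)
Definition close (x y : X) : option X := if y == x then None else Some y.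

Lemma bind_inst1_close (t s : term V X) x :
  bind (inst1 s) (rename (close x) t) = subst t s x.
Proof.
rewrite bind_rename; congr bind; apply/funext => y.
by rewrite /close; case: eqP.
Qed.

Hypothesis infX : infinite_set [set: X]%classic.

Lemma fresh N (f : X -> N) (t : term V N) : injective f ->
  exists x, ~ occurs (f x) t.
Proof.
move=> inj_f; apply: contrapT => /forallNP noct; apply: infX.
apply: sub_finite_set (_ : finite_set (f @^-1` [set y | occurs y t])%classic).
  by move=> x _ /=; apply: contrapT; apply: noct.
by apply: finite_preimage (finite_occurs t) => x y _ _; apply: inj_f.
Qed.

(** Calling the bound name by a name fresh for the body captures nothing. This carries equations
    stated for [mu x] over to every [Mu b]. *)
Lemma Mu_mu (b : term V (option X)) :
  exists x, b = rename (close x) (rename (odflt x) b).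
Proof.
have [x xb] := fresh b Some_inj; exists x.
rewrite rename_comp -[LHS]rename_id; apply: occurs_eq_rename => -[y|] yb /=.
  by rewrite /close; case: eqP => // yx; case: xb; rewrite -yx.
by rewrite /close eqxx.
Qed.

(** If [x] occurred in [t], then for a fresh [y] the binder [mu x] would bind this occurrence and
    [mu y] would leave it free. *)
Lemma closed_of_mu (t : term V X) : (forall x y, mu x t = mu y t) ->
  exists c : term V void, t = rename (of_void X) c.
Proof.
move=> mut; apply: rename_preimage => x xt; exfalso.
have [y yt] := fresh t (@inj_id X).
have [xy] := mut x y; have := eq_rename_occurs xy xt.
rewrite eqxx; case: eqP => // yx _.
by apply: yt; rewrite -yx.
Qed.

End NamedBinder.

(** * Expectations *)

Section Expectation.
Variables (R : realType) (L V : Type).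
Local Notation term := (@term R L V).
Implicit Types N M P : Type.

Definition observation N : Type := (L * term N + N)%type.

(** The step of a binder body seen from outside the binder: the result [None] marks the mass that
    returns to the bound name, and continuations are opened with [s]. *)
Definition lower N (s : term N) (o : observation (option N)) : option (observation N) :=
  match o with
  | inl (a, u) => Some (inl (a, bind (inst1 s) u))
  | inr o => omap inr o
  end.

(* The expectation of f under the sub-probability tau(t).  In the last case a
   fraction p of the mass of b returns to the binder; solving y = p y + y' gives
   the value below, which is 0 for p = 1 since then 1 - p has inverse 0. *)
Fixpoint Ev N (t : term N) (f : observation N -> R) : R :=
  match t with
  | Meta _ => 0
  | Name x => f (inr x)
  | Pref a u => f (inl (a, u))
  | Choice e u w => e%:num * Ev u f + (1 - e%:num) * Ev w f
  | Mu b => (1 - Ev b (fun o => (~~ isSome (lower (Mu b) o))%:R))^-1 *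
            Ev b (fun o => oapp f 0 (lower (Mu b) o))
  end.

Definition loop N (b : term (option N)) : R :=
  Ev b (fun o => if o is inr None then 1 else 0).

Lemma loopE N (b : term (option N)) s :
  Ev b (fun o => (~~ isSome (lower s o))%:R) = loop b.
Proof. by congr Ev; apply/funext => -[[]|[]]. Qed.

Lemma Ev_Mu N (b : term (option N)) f :
  Ev (Mu b) f = (1 - loop b)^-1 * Ev b (fun o => oapp f 0 (lower (Mu b) o)).
Proof. by rewrite /= loopE. Qed.

(** Finite support and total mass at most 1; linearity, monotonicity and bounds of [Ev] all follow.
    A list with possible repetitions is used because [L] and [N] are bare types, without decidable
    equality. *)
Lemma Ev_sum N (t : term N) : exists l : seq (R * observation N),
  [/\ forall f, Ev t f = \sum_(z <- l) z.1 * f z.2,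
      forall z, List.In z l -> 0 <= z.1 & \sum_(z <- l) z.1 <= 1].
Proof.
elim: t => {N} [N v|N x|N a u [l [lE l0 l1]]|
    N e u [l [lE l0 l1]] w [l' [lE' l0' l1']]|N b [l [lE l0 l1]]].
- by exists [::]; split => //= [f|]; rewrite big_nil.
- exists [:: (1, inr x)]; split => [f|z [<-|//]|]; rewrite ?big_seq1 ?mul1r //=.
- exists [:: (1, inl (a, u))]; split => [f|z [<-|//]|]; rewrite ?big_seq1 ?mul1r //=.
- exists ([seq (e%:num * z.1, z.2) | z <- l] ++
          [seq ((1 - e%:num) * z.1, z.2) | z <- l']); split.
  + move=> f /=; rewrite lE lE' big_cat !big_map /= !mulr_sumr.
    by congr +%R; apply: eq_bigr => z _; rewrite mulrA.
  + have e1 : 0 <= 1 - e%:num by rewrite subr_ge0.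
    move=> z /List.in_app_iff [] /List.in_map_iff [y [<- yl]] /=.
      by rewrite mulr_ge0 // l0.
    by rewrite mulr_ge0 // l0'.
  + rewrite big_cat !big_map /= -!mulr_sumr.
    have e0 : 0 <= e%:num by [].
    have e1 : 0 <= 1 - e%:num by rewrite subr_ge0.
    have := ler_wpM2l e0 l1; have := ler_wpM2l e1 l1'; lra.
- have pE : loop b = \sum_(z <- l | ~~ isSome (lower (Mu b) z.2)) z.1.
    rewrite -(loopE b (Mu b)) lE [RHS]big_mkcond /=; apply: eq_bigr => z _.
    by case: isSome; rewrite ?mulr1 ?mulr0.
  (* Returning and escaping mass add up to the total mass, so the escaping mass is at most
     [1 - loop b] and may be divided by it. *)
  have sE : loop b + \sum_(z <- l | isSome (lower (Mu b) z.2)) z.1 =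
            \sum_(z <- l) z.1.
    by rewrite pE addrC [RHS](bigID (fun z => isSome (lower (Mu b) z.2))).
  have s0 : 0 <= \sum_(z <- l | isSome (lower (Mu b) z.2)) z.1.
    elim: l l0 {lE l1 pE sE} => [|z l IH] l0; first by rewrite big_nil.
    rewrite big_cons; case: isSome; rewrite ?addr_ge0 ?l0 ?IH //; try by left.
      by move=> y yl; apply: l0; right.
    by move=> y yl; apply: l0; right.
  have p1 : loop b <= 1 by lra.
  have ip0 : 0 <= (1 - loop b)^-1 by rewrite invr_ge0 subr_ge0.
  exists (pmap (fun z =>
    omap (fun o => ((1 - loop b)^-1 * z.1, o)) (lower (Mu b) z.2)) l).
  split.
  + move=> f; rewrite Ev_Mu lE big_pmap mulr_sumr; apply: eq_bigr => z _.
    by case: lower => [o|] /=; rewrite ?mulr0 // mulrA.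
  + elim: l l0 {lE l1 pE sE s0} => [//|y l IH] l0 z /=.
    have {}IH := IH (fun y yl => l0 y (or_intror yl)) z.
    case: lower => [o|] //= -[<-|//] /=.
    by rewrite mulr_ge0 // l0 //; left.
  + rewrite big_pmap.
    under eq_bigr => z _.
      have -> : oapp fst 0 (omap (pair ((1 - loop b)^-1 * z.1)) (lower (Mu b) z.2)) =
         (1 - loop b)^-1 * (if isSome (lower (Mu b) z.2) then z.1 else 0).
        by case: lower => //=; rewrite mulr0.
      over.
    rewrite -mulr_sumr -big_mkcond /=.
    have [->|p_neq1] := eqVneq (loop b) 1; first by rewrite subrr invr0 mul0r.
    rewrite mulrC ler_pdivrMr; first by lra.
    by rewrite subr_gt0 lt_neqAle p_neq1.
Qed.

Lemma EvD N (t : term N) f g : Ev t (fun o => f o + g o) = Ev t f + Ev t g.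
Proof.
have [l [E _ _]] := Ev_sum t; rewrite !E -big_split; apply: eq_bigr => z _.
by rewrite mulrDr.
Qed.

Lemma EvZ N (t : term N) k f : Ev t (fun o => k * f o) = k * Ev t f.
Proof.
have [l [E _ _]] := Ev_sum t; rewrite !E mulr_sumr; apply: eq_bigr => z _.
by rewrite mulrCA.
Qed.

Lemma big_In_le (T : Type) (l : seq T) (f g : T -> R) :
  (forall z, List.In z l -> f z <= g z) -> \sum_(z <- l) f z <= \sum_(z <- l) g z.
Proof.
elim: l => [|z l IH] fg; first by rewrite !big_nil.
rewrite !big_cons lerD ?fg ?IH //; first by left.
by move=> y yl; apply: fg; right.
Qed.

Lemma le_Ev N (t : term N) f g : (forall o, f o <= g o) -> Ev t f <= Ev t g.
Proof.
move=> fg; have [l [E l0 _]] := Ev_sum t; rewrite !E.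
by apply: big_In_le => z /l0 z0; rewrite ler_wpM2l.
Qed.

Lemma Ev_cst0 N (t : term N) : Ev t (fun=> 0) = 0.
Proof. by have [l [E _ _]] := Ev_sum t; rewrite E big1 // => z _; rewrite mulr0. Qed.

Lemma Ev_ge0 N (t : term N) f : (forall o, 0 <= f o) -> 0 <= Ev t f.
Proof. by move=> f0; rewrite -(Ev_cst0 t) le_Ev. Qed.

Lemma Ev_le1 N (t : term N) f : (forall o, f o <= 1) -> Ev t f <= 1.
Proof.
move=> f1; apply: (le_trans (le_Ev t f1)).
have [l [E l0 l1]] := Ev_sum t; rewrite E; apply: le_trans l1.
by apply: big_In_le => z _; rewrite mulr1.
Qed.

Lemma loop_le1 N (b : term (option N)) : loop b <= 1.
Proof. by apply: Ev_le1 => -[[]|[]]. Qed.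

(** The total mass is at most 1, so a body that returns surely has no mass elsewhere. *)
Lemma Ev_loop1 N (b : term (option N)) f : loop b = 1 -> f (inr None) = 0 ->
  Ev b f = 0.
Proof.
have [l [E l0 l1]] := Ev_sum b.
rewrite /loop !E => p1 f0.
pose h (o : observation (option N)) : R := if o is inr None then 1 else 0.
have hz z : List.In z l -> z.1 * (1 - h z.2) = 0.
  have z0 y : List.In y l -> 0 <= y.1 * (1 - h y.2).
    move=> /l0 y0; rewrite mulr_ge0 // subr_ge0 /h; case: y.2 => [//|[]//].
  have : \sum_(y <- l) y.1 * (1 - h y.2) <= 0.
    under eq_bigr do rewrite mulrBr mulr1.
    by rewrite sumrB p1 subr_le0.
  elim: l z0 {E l0 l1 p1} => [//|y l IH] z0; rewrite big_cons => s0 zl.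
  have y0 := z0 y (or_introl erefl).
  have s1 : 0 <= \sum_(y <- l) y.1 * (1 - h y.2).
    apply: (@le_trans _ _ (\sum_(y <- l) 0)); first by rewrite big1.
    by apply: big_In_le => x xl; apply: z0; right.
  case: zl => [<-|zl].
    by apply/eqP; rewrite eq_le y0 andbT; lra.
  by apply: IH zl => [x xl|]; [apply: z0; right|lra].
elim: l hz {E l0 l1 p1} => [|z l IH] hz; first by rewrite big_nil.
rewrite big_cons IH ?addr0; last by move=> y yl; apply: hz; right.
have := hz z (or_introl erefl); rewrite /h.
case: z.2 => [au|[x|]]; rewrite ?f0 ?mulr0 // subr0 mulr1 => ->; by rewrite mul0r.
Qed.

Definition obs_rename N M (r : N -> M) (o : observation N) : observation M :=
  match o with inl (a, u) => inl (a, rename r u) | inr x => inr (r x) end.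

Lemma Ev_rename N M (r : N -> M) (t : term N) f :
  Ev (rename r t) f = Ev t (fun o => f (obs_rename r o)).
Proof.
elim: t M r f => {N} [N v|N x|N a u IHu|N e u IHu w IHw|N b IHb] M r f //.
- by rewrite /= IHu IHw.
- rewrite [rename _ _]/= !Ev_Mu /loop !IHb; congr (_^-1 * _).
    by congr (1 - Ev _ _); apply/funext => -[[]|[]].
  congr Ev; apply/funext => -[[a u]|[x|]] //=.
  congr (f (inl (a, _))); rewrite bind_rename rename_bind; congr bind.
  by apply/funext => -[].
Qed.

(** When a free name [x] is observed, the term [r x] put in its place makes the next observation. *)
Definition pull N M (r : N -> term M) (f : observation M -> R) (o : observation N) : R :=
  match o with inl (a, u) => f (inl (a, bind r u)) | inr x => Ev (r x) f end.

Lemma Ev_bind N M (r : N -> term M) (t : term N) f :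
  Ev (bind r t) f = Ev t (pull r f).
Proof.
elim: t M r f => {N} [N v|N x|N a u IHu|N e u IHu w IHw|N b IHb] M r f //.
- by rewrite /= IHu IHw.
- rewrite bind_Mu !Ev_Mu /loop !IHb; congr (_^-1 * _).
    (* The terms substituted for outer names never show the bound name, so the returning mass is
       unchanged. *)
    congr (1 - Ev _ _); apply/funext => -[[a u]|[x|]] //=.
    rewrite Ev_rename -[RHS](Ev_cst0 (r x)); congr Ev.
    by apply/funext => -[[]|].
  congr Ev; apply/funext => -[[a u]|[x|]] //=.
    by congr (f (inl (a, _))); rewrite bind_inst1.
  rewrite Ev_rename; congr Ev; apply/funext => -[[a u]|y] //=.
  by rewrite bind_rename bind_Name.
Qed.

(** For [s := Mu b] this is the equation [y = p y + y'] solved in the definition of [Ev]. *)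
Lemma Ev_split N (b : term (option N)) s f :
  Ev b (pull (inst1 s) f) =
  loop b * Ev s f + Ev b (fun o => oapp f 0 (lower s o)).
Proof.
rewrite mulrC -EvZ -EvD; congr Ev; apply/funext => -[[a u]|[x|]] /=;
  by rewrite ?mulr0 ?mulr1 ?add0r ?addr0.
Qed.

Lemma Ev_unfold N (b : term (option N)) f :
  Ev (Mu b) f = Ev (bind (inst1 (Mu b)) b) f.
Proof.
rewrite Ev_bind Ev_split Ev_Mu.
(* For [p = 1] both sides are 0: the left by the convention on inverses, the right because no mass
   escapes. *)
have [p1|p_neq1] := eqVneq (loop b) 1.
  by rewrite p1 subrr invr0 mul0r mulr0 add0r Ev_loop1.
have : 1 - loop b != 0 by rewrite subr_eq0 eq_sym.
by move=> ?; field.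
Qed.

(** A guarded name has probability 0 of being the next observation: a prefix hides it, and a choice
    of weight 0 or 1 discards the argument that may expose it. *)
Lemma Ev_guarded N (t : term N) (x : N) f g : guarded x t ->
  (forall o, o <> inr x -> f o = g o) -> Ev t f = Ev t g.
Proof.
elim: t x f g => {N} [N v|N y|N a u IHu|N e u IHu w IHw|N b IHb] x f g gx fg.
- by [].
- by rewrite /= fg // => -[] /gx.
- by rewrite /= fg.
- case: gx => gu gw /=; congr +%R.
    by case: gu => [->|/IHu /(_ fg) ->] //; rewrite !mul0r.
  by case: gw => [->|/IHw /(_ fg) ->] //; rewrite subrr !mul0r.
- rewrite !Ev_Mu; congr (_ * _); apply: IHb gx _ => -[[a u]|[y|]] //= yx.
    by rewrite fg.
  by rewrite fg // => -[yx']; apply: yx; rewrite yx'.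
Qed.

End Expectation.

(** * Kantorovich distance *)

Section FiniteSums.
Variables (R : realType) (A : choiceType).
Implicit Types (s : seq A) (p q : A -> R).

(** A covering list may exceed the support, so that several distributions can share one list. *)
Definition covers s p : Prop := forall x, p x != 0 -> x \in s.

Lemma fsum_seq s f : uniq s -> covers s f ->
  \sum_(x \in [set: A]) f x = \sum_(x <- s) f x.
Proof.
move=> us sf; rewrite [RHS](fsbig_seq _ _ us); symmetry.
apply: fsbig_widen => // x /= [_ xs].
by apply/eqP; apply: contrapT => /negP /sf.
Qed.

Lemma fsum_seq2 s (f : A * A -> R) : uniq s ->
  (forall x y, f (x, y) != 0 -> (x \in s) && (y \in s)) ->
  \sum_(z \in [set: A * A]) f z = \sum_(x <- s) \sum_(y <- s) f (x, y).
Proof.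
move=> us sf.
have u2 : uniq [seq (x, y) | x <- s, y <- s].
  by rewrite allpairs_uniq // => -[? ?] [? ?].
rewrite -[RHS]big_allpairs [RHS](fsbig_seq _ _ u2).
symmetry; apply: fsbig_widen => // -[x y] /= [_ xs].
apply/eqP; apply: contrapT => /negP /sf /andP[xs' ys]; apply: xs.
exact: allpairs_f.
Qed.

Lemma sum_delta s x (f : A -> R) : uniq s -> x \in s ->
  \sum_(y <- s) (x == y)%:R * f y = f x.
Proof.
move=> us xs; rewrite (bigD1_seq x) //= eqxx mul1r big1 ?addr0 // => y.
by rewrite eq_sym => /negPf ->; rewrite mul0r.
Qed.

Lemma fdist_cover p : is_fdist p -> exists2 s, uniq s & covers s p.
Proof.
case=> _ /finite_seqP [s sE] _; exists (undup s); first exact: undup_uniq.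
move=> x px; rewrite mem_undup.
have : [set x | p x != 0]%classic x by [].
by rewrite sE.
Qed.

Lemma fdist_cover2 p q : is_fdist p -> is_fdist q ->
  exists s, [/\ uniq s, covers s p & covers s q].
Proof.
move=> /fdist_cover [s _ sp] /fdist_cover [s' _ sq].
exists (undup (s ++ s')); split; first exact: undup_uniq.
  by move=> x /sp; rewrite mem_undup mem_cat => ->.
by move=> x /sq; rewrite mem_undup mem_cat orbC => ->.
Qed.

Lemma fdist_sum p s : is_fdist p -> uniq s -> covers s p -> \sum_(x <- s) p x = 1.
Proof. by case=> _ _ p1 us sp; rewrite -fsum_seq. Qed.

Lemma fdistI p s : uniq s -> covers s p -> (forall x, 0 <= p x) ->
  \sum_(x <- s) p x = 1 -> is_fdist p.
Proof.
move=> us sp p0 p1; split => //; last by rewrite (fsum_seq us).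
by apply: (@sub_finite_set _ _ [set` s]%classic) => //; exact: finite_seq.
Qed.

End FiniteSums.

(** * Couplings and the laws of the Kantorovich distance *)

Section Kantorovich.
Variables (R : realType) (A : choiceType).
Implicit Types (s : seq A) (p q r : A -> R) (m : A -> A -> R).

Definition coupling_on s p q (w : A -> A -> R) : Prop :=
  [/\ forall x y, 0 <= w x y,
      forall x y, w x y != 0 -> (x \in s) && (y \in s),
      forall x, \sum_(y <- s) w x y = p x &
      forall y, \sum_(x <- s) w x y = q y].

Definition cost m s (w : A -> A -> R) : R :=
  \sum_(x <- s) \sum_(y <- s) m x y * w x y.

Lemma sum_seq_ge (s : seq A) (f : A -> R) x : uniq s -> (forall y, 0 <= f y) -> x \in s ->
  f x <= \sum_(y <- s) f y.
Proof.
by move=> us f0 xs; rewrite (bigD1_seq x) //= lerDl sumr_ge0.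
Qed.

Lemma coupling_on_is_coupling s p q w : uniq s -> is_fdist p ->
  coupling_on s p q w -> is_coupling p q (fun z => w z.1 z.2).
Proof.
move=> us fp [w0 ws wp wq].
have sp : covers s p.
  move=> x; apply: contraR => xs; rewrite -wp big1 // => y _; apply/eqP.
  by apply: contraNT xs => /ws /andP[].
have w1 : \sum_(z \in [set: A * A]) w z.1 z.2 = 1.
  rewrite (fsum_seq2 (s := s)) //= -(fdist_sum fp us sp).
  by apply: eq_bigr => x _; rewrite wp.
split.
- split => //; apply: (@sub_finite_set _ _ [set` [seq (x, y) | x <- s, y <- s]]%classic).
    by move=> [x y] /= /ws /andP[xs ys]; apply: allpairs_f.
  exact: finite_seq.
- by move=> x; rewrite (fsum_seq us) => [|y /= /ws /andP[]] //=; apply: wp.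
- by move=> y; rewrite (fsum_seq us) => [|x /= /ws /andP[]] //=; apply: wq.
Qed.

Lemma fsum_ge_term (B : choiceType) (f : B -> R) x :
  finite_set [set y | f y != 0]%classic -> (forall y, 0 <= f y) -> f x <= \sum_(y \in [set: B]) f y.
Proof.
move=> /finite_seqP [s sE] f0.
have sf : covers (undup (x :: s)) f.
  move=> y fy; rewrite mem_undup inE; apply/orP; right.
  have : [set y | f y != 0]%classic y by [].
  by rewrite sE.
rewrite (fsum_seq (undup_uniq _) sf) (bigD1_seq x) ?undup_uniq //.
  by rewrite lerDl sumr_ge0.
by rewrite mem_undup mem_head.
Qed.

(** A pair of positive weight makes both its marginals positive, so the support of [w] lies in the
    square of [s]. *)
Lemma is_coupling_on s p q w : uniq s -> covers s p -> covers s q ->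
  is_coupling p q w -> coupling_on s p q (fun x y => w (x, y)).
Proof.
move=> us sp sq [[w0 wf w1] wp wq].
have wfx x : finite_set [set y | w (x, y) != 0]%classic.
  apply: (@finite_preimage _ _ [set z | w z != 0]%classic (fun y => (x, y))) => //.
  by move=> ? ? _ _ [].
have wfy y : finite_set [set x | w (x, y) != 0]%classic.
  apply: (@finite_preimage _ _ [set z | w z != 0]%classic (fun x => (x, y))) => //.
  by move=> ? ? _ _ [].
have ws x y : w (x, y) != 0 -> (x \in s) && (y \in s).
  move=> wxy; have wgt0 : 0 < w (x, y) by rewrite lt_neqAle eq_sym wxy w0.
  apply/andP; split.
    apply/sp; rewrite gt_eqF // (lt_le_trans wgt0) // -wp.
    exact: (fsum_ge_term (f := fun y => w (x, y))).
  apply/sq; rewrite gt_eqF // (lt_le_trans wgt0) // -wq.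
  exact: (fsum_ge_term (f := fun x => w (x, y))).
split => //.
- by move=> x; rewrite -(fsum_seq us) // => y /ws /andP[].
- by move=> y; rewrite -(fsum_seq us (f := fun x => w (x, y))) // => x /ws /andP[].
Qed.

Lemma cost_fsum m s p q w : uniq s -> coupling_on s p q w ->
  \sum_(z \in [set: A * A]) m z.1 z.2 * w z.1 z.2 = cost m s w.
Proof.
move=> us [_ ws _ _]; apply: (fsum_seq2 (s := s)) => // x y /= mw.
by apply: ws; apply: contraNneq mw => ->; rewrite mulr0.
Qed.

Lemma kantorovich_le m s p q w : (forall x y, 0 <= m x y) -> uniq s ->
  is_fdist p -> coupling_on s p q w -> kantorovich m p q <= cost m s w.
Proof.
move=> m0 us fp cw; apply: ge_inf.
  exists 0 => _ [v [[v0 _ _] _ _] <-]; apply: fsumr_ge0 => z _.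
  by rewrite mulr_ge0.
exists (fun z => w z.1 z.2); first exact: coupling_on_is_coupling cw.
exact: cost_fsum cw.
Qed.

Lemma product_coupling s p q : uniq s -> is_fdist p -> is_fdist q -> covers s p ->
  covers s q -> coupling_on s p q (fun x y => p x * q y).
Proof.
move=> us fp fq sp sq; have [p0 _ _] := fp; have [q0 _ _] := fq.
split => [x y|x y|x|y]; first by rewrite mulr_ge0.
- by rewrite mulf_eq0 negb_or => /andP[/sp -> /sq ->].
- by rewrite -mulr_sumr (fdist_sum fq) ?mulr1.
- by rewrite -mulr_suml (fdist_sum fp) ?mul1r.
Qed.

(** Near-optimal couplings replace optimal ones, so no compactness argument is needed; the product
    coupling shows that the infimum is over a nonempty set. *)
Lemma kantorovich_coupling m s p q e : (forall x y, 0 <= m x y) -> uniq s ->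
  is_fdist p -> is_fdist q -> covers s p -> covers s q -> 0 < e ->
  exists2 w, coupling_on s p q w & cost m s w < kantorovich m p q + e.
Proof.
move=> m0 us fp fq sp sq e0.
have [|c [w cw <-] we] := inf_adherent e0 (E := [set \sum_(z \in [set: A * A])
   m z.1 z.2 * w z | w in is_coupling p q]%classic).
  split; last first.
    exists 0 => _ [v [[v0 _ _] _ _] <-]; apply: fsumr_ge0 => z _.
    by rewrite mulr_ge0.
  have cpq := product_coupling us fp fq sp sq.
  eexists; exists (fun z => p z.1 * q z.2) => //.
  exact: coupling_on_is_coupling us fp cpq.
have cw' := is_coupling_on us sp sq cw.
exists (fun x y => w (x, y)) => //; rewrite -(cost_fsum _ us cw').
by under eq_fsbigr => z _ do rewrite -surjective_pairing.
Qed.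

Lemma kantorovich_ge0 m p q : (forall x y, 0 <= m x y) -> 0 <= kantorovich m p q.
Proof.
move=> m0; rewrite /kantorovich; set E := (X in inf X).
(* Arbitrary [p] and [q] may have no coupling; the infimum is then 0 by convention. *)
have [[x Ex]|/nonemptyPn ->] := pselect (E !=set0)%classic; last by rewrite inf0.
apply: lb_le_inf; first by exists x.
move=> _ [v [[v0 _ _] _ _] <-]; apply: fsumr_ge0 => z _.
by rewrite mulr_ge0.
Qed.

Lemma coupling_dominated s p q w x y : uniq s -> coupling_on s p q w ->
  w x y != 0 -> p x != 0 /\ q y != 0.
Proof.
move=> us [w0 ws wp wq] wxy; have /andP[xs ys] := ws _ _ wxy.
have wgt0 : 0 < w x y by rewrite lt_neqAle eq_sym wxy w0.
split; rewrite gt_eqF // (lt_le_trans wgt0) //.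
  by rewrite -wp; apply: (sum_seq_ge (f := w x)).
by rewrite -wq; apply: (sum_seq_ge (f := w^~ y)).
Qed.

Lemma le_cost m m' s w : (forall x y, 0 <= w x y) ->
  (forall x y, m x y <= m' x y) -> cost m s w <= cost m' s w.
Proof.
by move=> w0 mm; apply: ler_sum => x _; apply: ler_sum => y _; rewrite ler_wpM2r.
Qed.

Lemma kantorovich_refl m p : (forall x y, 0 <= m x y) -> (forall x, m x x = 0) ->
  is_fdist p -> kantorovich m p p = 0.
Proof.
move=> m0 mxx fp; have [s us sp] := fdist_cover fp; have [p0 _ _] := fp.
apply/eqP; rewrite eq_le kantorovich_ge0 // andbT.
have cp : coupling_on s p p (fun x y => (x == y)%:R * p y).
  have sE x : \sum_(y <- s) (x == y)%:R * p y = p x.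
    have [xs|xs] := boolP (x \in s); first exact: sum_delta.
    have -> : p x = 0 by apply/eqP; apply: contraNT xs => /sp.
    rewrite big_seq big1 // => y ys; case: eqP xs => [->|]; last by rewrite mul0r.
    by rewrite ys.
  split => // [x y|x y|y]; first by rewrite mulr_ge0.
    by case: (eqVneq x y) => [->|_]; rewrite ?mul0r ?mul1r ?eqxx // => /sp ->.
  rewrite -[RHS]sE; apply: eq_bigr => x _; rewrite eq_sym.
  by case: eqP => [->|]; rewrite ?mul0r.
apply: (le_trans (kantorovich_le m0 us fp cp)).
rewrite /cost big1 // => x _; rewrite big1 // => y _.
by case: eqP => [->|]; rewrite ?mxx ?mul0r ?mulr0.
Qed.

Lemma kantorovich_le_product m s p q : (forall x y, 0 <= m x y) -> uniq s ->
  is_fdist p -> is_fdist q -> covers s p -> covers s q ->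
  kantorovich m p q <= \sum_(x <- s) p x * \sum_(y <- s) q y * m x y.
Proof.
move=> m0 us fp fq sp sq.
apply: (le_trans (kantorovich_le m0 us fp (product_coupling us fp fq sp sq))).
rewrite /cost [leLHS](eq_bigr (fun x => p x * \sum_(y <- s) q y * m x y)) // => x _.
by rewrite mulr_sumr; apply: eq_bigr => y _; ring.
Qed.

Lemma kantorovich_le1 m p q : (forall x y, 0 <= m x y <= 1) -> is_fdist p ->
  is_fdist q -> kantorovich m p q <= 1.
Proof.
move=> m01 fp fq; have [s [us sp sq]] := fdist_cover2 fp fq.
have m0 x y : 0 <= m x y by have /andP[] := m01 x y.
have [p0 _ _] := fp; have [q0 _ _] := fq.
apply: (le_trans (kantorovich_le_product m0 us fp fq sp sq)).
rewrite -(fdist_sum fp us sp); apply: ler_sum => x _; rewrite ler_piMr //.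
rewrite -(fdist_sum fq us sq); apply: ler_sum => y _; rewrite ler_piMr //.
by have /andP[] := m01 x y.
Qed.

Lemma kantorovich_mono m m' p q : (forall x y, 0 <= m x y) ->
  (forall x y, m x y <= m' x y) -> is_fdist p -> is_fdist q ->
  kantorovich m p q <= kantorovich m' p q.
Proof.
move=> m0 mm fp fq; have [s [us sp sq]] := fdist_cover2 fp fq.
apply/ler_addgt0Pr => e e0.
have m0' x y : 0 <= m' x y by apply: le_trans (mm x y).
have [w cw we] := kantorovich_coupling m0' us fp fq sp sq e0.
apply: (le_trans (kantorovich_le m0 us fp cw)); apply: le_trans (ltW we).
by apply: le_cost => //; case: cw.
Qed.

Lemma kantorovich_sym_le m p q : (forall x y, 0 <= m x y) ->
  (forall x y, m x y = m y x) -> is_fdist p -> is_fdist q ->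
  kantorovich m p q <= kantorovich m q p.
Proof.
move=> m0 mC fp fq; have [s [us sp sq]] := fdist_cover2 fp fq.
apply/ler_addgt0Pr => e e0.
have [w cw we] := kantorovich_coupling m0 us fq fp sq sp e0.
have cw' : coupling_on s p q (fun x y => w y x).
  by case: cw => w0 ws wp wq; split => // x y /ws; rewrite andbC.
apply: (le_trans (kantorovich_le m0 us fp cw')); apply: le_trans (ltW we).
rewrite /cost exchange_big /= [leLHS](eq_bigr (fun x => \sum_(y <- s) m x y * w x y)) //.
by move=> x _; apply: eq_bigr => y _; rewrite mC.
Qed.

Lemma kantorovich_triangle m p q r : (forall x y, 0 <= m x y) ->
  (forall x y z, m x z <= m x y + m y z) ->
  is_fdist p -> is_fdist q -> is_fdist r ->
  kantorovich m p r <= kantorovich m p q + kantorovich m q r.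
Proof.
move=> m0 mT fp fq fr; have [s0 [us0 sp0 sq0]] := fdist_cover2 fp fq.
have [s1 us1 sr1] := fdist_cover fr; pose s := undup (s0 ++ s1).
have us : uniq s := undup_uniq _.
have sp : covers s p by move=> x /sp0; rewrite mem_undup mem_cat => ->.
have sq : covers s q by move=> x /sq0; rewrite mem_undup mem_cat => ->.
have sr : covers s r by move=> x /sr1; rewrite mem_undup mem_cat orbC => ->.
apply/ler_addgt0Pr => e e0; have e20 : 0 < e / 2 by rewrite divr_gt0.
have [w1 c1 lt1] := kantorovich_coupling m0 us fp fq sp sq e20.
have [w2 c2 lt2] := kantorovich_coupling m0 us fq fr sq sr e20.
have [w10 ws1 wp1 wq1] := c1; have [w20 ws2 wp2 wq2] := c2; have [q0 _ _] := fq.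
(* Gluing along [q]: given the middle point [y], the two couplings are taken independent. Where
   [q y = 0] both of them vanish, so the inverse 0 is harmless. *)
pose w x z := \sum_(y <- s) w1 x y * w2 y z / q y.
have K1 x y : w1 x y * q y / q y = w1 x y.
  have [->|w1n0] := eqVneq (w1 x y) 0; first by rewrite !mul0r.
  by have [_ qn0] := coupling_dominated us c1 w1n0; rewrite mulfK.
have K2 y z : q y * w2 y z / q y = w2 y z.
  have [->|w2n0] := eqVneq (w2 y z) 0; first by rewrite mulr0 mul0r.
  by have [qn0 _] := coupling_dominated us c2 w2n0; rewrite mulrAC divff ?mul1r.
have S1 x y : \sum_(z <- s) w1 x y * w2 y z / q y = w1 x y.
  by rewrite -mulr_suml -mulr_sumr wp2 K1.
have S2 y z : \sum_(x <- s) w1 x y * w2 y z / q y = w2 y z.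
  by rewrite -mulr_suml -mulr_suml wq1 K2.
have cw : coupling_on s p r w.
  split => [x y|x z|x|z].
  - by apply: sumr_ge0 => z _; rewrite divr_ge0 ?mulr_ge0.
  - apply: contraR; rewrite negb_and => xz; rewrite /w big1 // => y _.
    case/orP: xz => [xs|zs].
      rewrite (_ : w1 x y = 0) ?mul0r //.
      by apply/eqP; apply: contraNT xs => /ws1 /andP[].
    rewrite (_ : w2 y z = 0) ?mulr0 ?mul0r //.
    by apply/eqP; apply: contraNT zs => /ws2 /andP[].
  - by rewrite exchange_big /= -wp1; apply: eq_bigr => y _.
  - by rewrite exchange_big /= -wq2; apply: eq_bigr => y _.
apply: (le_trans (kantorovich_le m0 us fp cw)).
suff : cost m s w <= cost m s w1 + cost m s w2 by lra.
have -> : cost m s w1 =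
    \sum_(x <- s) \sum_(z <- s) \sum_(y <- s) m x y * (w1 x y * w2 y z / q y).
  apply: eq_bigr => x _; rewrite exchange_big; apply: eq_bigr => y _ /=.
  by rewrite -mulr_sumr S1.
have -> : cost m s w2 =
    \sum_(x <- s) \sum_(z <- s) \sum_(y <- s) m y z * (w1 x y * w2 y z / q y).
  rewrite /cost exchange_big [RHS]exchange_big; apply: eq_bigr => z _ /=.
  rewrite [RHS]exchange_big; apply: eq_bigr => y _ /=.
  by rewrite -mulr_sumr S2.
rewrite -big_split; apply: ler_sum => x _; rewrite -big_split; apply: ler_sum => z _ /=.
rewrite -big_split mulr_sumr; apply: ler_sum => y _ /=.
by rewrite -mulrDl ler_wpM2r // divr_ge0 ?mulr_ge0.
Qed.

Lemma kantorovich_convex m (c : R) p1 q1 p2 q2 : (forall x y, 0 <= m x y) ->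
  0 <= c <= 1 -> is_fdist p1 -> is_fdist q1 -> is_fdist p2 -> is_fdist q2 ->
  kantorovich m (fun x => c * p1 x + (1 - c) * p2 x) (fun x => c * q1 x + (1 - c) * q2 x)
  <= c * kantorovich m p1 q1 + (1 - c) * kantorovich m p2 q2.
Proof.
move=> m0 /andP[c0 c1] fp1 fq1 fp2 fq2.
have [s1 [us1 sp1 sq1]] := fdist_cover2 fp1 fq1.
have [s2 [us2 sp2 sq2]] := fdist_cover2 fp2 fq2.
pose s := undup (s1 ++ s2); have us : uniq s := undup_uniq _.
have {}sp1 : covers s p1 by move=> x /sp1; rewrite mem_undup mem_cat => ->.
have {}sq1 : covers s q1 by move=> x /sq1; rewrite mem_undup mem_cat => ->.
have {}sp2 : covers s p2 by move=> x /sp2; rewrite mem_undup mem_cat orbC => ->.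
have {}sq2 : covers s q2 by move=> x /sq2; rewrite mem_undup mem_cat orbC => ->.
apply/ler_addgt0Pr => e e0; have c1' : 0 <= 1 - c by rewrite subr_ge0.
have [w1 cw1 lt1] := kantorovich_coupling m0 us fp1 fq1 sp1 sq1 e0.
have [w2 cw2 lt2] := kantorovich_coupling m0 us fp2 fq2 sp2 sq2 e0.
pose w x y := c * w1 x y + (1 - c) * w2 x y.
have cw : coupling_on s (fun x => c * p1 x + (1 - c) * p2 x)
                        (fun x => c * q1 x + (1 - c) * q2 x) w.
  have [w10 ws1 wp1 wq1] := cw1; have [w20 ws2 wp2 wq2] := cw2.
  split => [x y|x y|x|y]; first by rewrite addr_ge0 ?mulr_ge0.
  - apply: contraR => nxy; rewrite /w.
    have -> : w1 x y = 0 by apply/eqP; apply: contraNT nxy => /ws1.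
    have -> : w2 x y = 0 by apply/eqP; apply: contraNT nxy => /ws2.
    by rewrite !mulr0 addr0.
  - by rewrite /w big_split /= -!mulr_sumr wp1 wp2.
  - by rewrite /w big_split /= -!mulr_sumr wq1 wq2.
have fp : is_fdist (fun x => c * p1 x + (1 - c) * p2 x).
  have [p10 _ _] := fp1; have [p20 _ _] := fp2.
  apply: (fdistI us) => [x|x|]; last 2 first.
  - by rewrite addr_ge0 ?mulr_ge0.
  - by rewrite big_split /= -!mulr_sumr !(fdist_sum _ us) // !mulr1 subrKC.
  apply: contraR => xs.
  have -> : p1 x = 0 by apply/eqP; apply: contraNT xs => /sp1.
  have -> : p2 x = 0 by apply/eqP; apply: contraNT xs => /sp2.
  by rewrite !mulr0 addr0.
apply: (le_trans (kantorovich_le m0 us fp cw)).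
have -> : cost m s w = c * cost m s w1 + (1 - c) * cost m s w2.
  rewrite /cost !mulr_sumr -big_split; apply: eq_bigr => x _ /=.
  rewrite !mulr_sumr -big_split; apply: eq_bigr => y _ /=.
  by rewrite /w; ring.
have := ler_wpM2l c0 (ltW lt1); have := ler_wpM2l c1' (ltW lt2); lra.
Qed.

Lemma fdist_dirac (x : A) : is_fdist (fun y => (x == y)%:R : R).
Proof.
apply: (@fdistI _ _ _ [:: x]) => // [y|]; last by rewrite big_seq1 eqxx.
by case: (eqVneq x y) => [->|_]; rewrite ?mem_head ?eqxx.
Qed.

Lemma kantorovich_dirac m x y : (forall x y, 0 <= m x y) ->
  kantorovich m (fun z => (x == z)%:R) (fun z => (y == z)%:R) <= m x y.
Proof.
move=> m0; pose s := undup [:: x; y]; have us : uniq s := undup_uniq _.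
have xs : x \in s by rewrite mem_undup mem_head.
have ys : y \in s by rewrite mem_undup inE mem_head orbT.
have sx : covers s (fun z => (x == z)%:R : R).
  by move=> z; case: (eqVneq _ z) => [<-|_]; rewrite ?eqxx.
have sy : covers s (fun z => (y == z)%:R : R).
  by move=> z; case: (eqVneq _ z) => [<-|_]; rewrite ?eqxx.
apply: (le_trans (kantorovich_le_product m0 us (fdist_dirac x) (fdist_dirac y) sx sy)).
by rewrite sum_delta // sum_delta.
Qed.

(* Within each class of e, take the product of p and q normalized by the
   common mass of the class. *)
Lemma kantorovich_equiv m (e : rel A) p q s : (forall x y, 0 <= m x y) ->
  (forall x y, e x y -> m x y = 0) -> equivalence_rel e ->
  is_fdist p -> is_fdist q -> uniq s -> covers s p -> covers s q ->
  (forall x, \sum_(y <- s) p y * (e x y)%:R = \sum_(y <- s) q y * (e x y)%:R) ->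
  kantorovich m p q = 0.
Proof.
move=> m0 em eqe fp fq us sp sq epq; have [p0 _ _] := fp; have [q0 _ _] := fq.
apply/eqP; rewrite eq_le kantorovich_ge0 // andbT.
pose M x := \sum_(y <- s) p y * (e x y)%:R.
have exx x : e x x by have [] := eqe x x x.
have eC x y : e x y = e y x.
  have [_ h] := eqe x y x; have [_ h'] := eqe y x y.
  by apply/idP/idP => [/h|/h']; rewrite exx => <-.
have eM x y : e x y -> M x = M y.
  by move=> exy; apply: eq_bigr => z _; have [_ ->] := eqe x y z.
(* Classes of mass 0 carry neither [p] nor [q], so the division by [M x] in [w] is harmless. *)
have pM x : M x = 0 -> p x = 0.
  move=> Mx; have [//|px] := eqVneq (p x) 0; have xs := sp _ px.
  have : p x * (e x x)%:R <= M x.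
    by apply: (@sum_seq_ge _ (fun y => p y * (e x y)%:R)) => // y; rewrite mulr_ge0.
  by rewrite exx mulr1 Mx => px0; apply/eqP; rewrite eq_le px0 p0.
have qM x : M x = 0 -> q x = 0.
  move=> Mx; have [//|qx] := eqVneq (q x) 0; have xs := sq _ qx.
  have : q x * (e x x)%:R <= M x.
    rewrite /M epq.
    by apply: (@sum_seq_ge _ (fun y => q y * (e x y)%:R)) => // y; rewrite mulr_ge0.
  by rewrite exx mulr1 Mx => qx0; apply/eqP; rewrite eq_le qx0 q0.
have M0 x : 0 <= M x by apply: sumr_ge0 => y _; rewrite mulr_ge0.
pose w x y := p x / M x * (q y * (e x y)%:R).
have cw : coupling_on s p q w.
  split => [x y|x y|x|y].
  - by rewrite mulr_ge0 ?divr_ge0 ?mulr_ge0.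
  - by rewrite !mulf_eq0 !negb_or => /andP[/andP[/sp -> _]] /andP[/sq ->].
  - rewrite -mulr_sumr -epq -/(M x).
    by have [M0x|] := eqVneq (M x) 0; [rewrite M0x mulr0 pM|move=> ?; rewrite mulfVK].
  - transitivity (q y / M y * \sum_(x <- s) p x * (e y x)%:R).
      rewrite mulr_sumr; apply: eq_bigr => x _; rewrite /w eC.
      have [/eM ->|_] := boolP (e y x); first by ring.
      by rewrite !mulr0.
    rewrite -/(M y).
    by have [M0y|] := eqVneq (M y) 0; [rewrite M0y mulr0 qM|move=> ?; rewrite mulfVK].
apply: (le_trans (kantorovich_le m0 us fp cw)).
rewrite /cost big1 // => x _; rewrite big1 // => y _; rewrite /w.
by have [/em ->|_] := boolP (e x y); rewrite ?mul0r ?mulr0.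
Qed.

(** The easy half of Kantorovich duality: the two sums differ by at most a Lipschitz constant of [F]
    times the cost of a coupling, and this cost can be made arbitrarily small. *)
Lemma kantorovich_eq0 m p q s (F : A -> R) : (forall x y, 0 <= m x y) ->
  (forall x y, m x y = 0 -> F x = F y) -> is_fdist p -> is_fdist q ->
  uniq s -> covers s p -> covers s q -> kantorovich m p q = 0 ->
  \sum_(x <- s) p x * F x = \sum_(x <- s) q x * F x.
Proof.
move=> m0 mF fp fq us sp sq K0.
(* F is Lipschitz for m on the finite set s, with constant C. *)
pose C := \sum_(x <- s) \sum_(y <- s) `|F x - F y| / m x y.
have C0 : 0 <= C by apply: sumr_ge0 => x _; apply: sumr_ge0 => y _; rewrite divr_ge0.
have FC x y : x \in s -> y \in s -> `|F x - F y| <= C * m x y.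
  move=> xs ys; have [mxy|mxy] := eqVneq (m x y) 0.
    by rewrite mxy mulr0 (mF _ _ mxy) subrr normr0.
  have mgt0 : 0 < m x y by rewrite lt_neqAle eq_sym mxy m0.
  rewrite -ler_pdivrMr //; apply: (@le_trans _ _ (\sum_(y <- s) `|F x - F y| / m x y)).
    apply: (@sum_seq_ge _ (fun y => `|F x - F y| / m x y)) => // z.
    by rewrite divr_ge0.
  apply: (@sum_seq_ge _ (fun x => \sum_(y <- s) `|F x - F y| / m x y)) => // z.
  by apply: sumr_ge0 => t _; rewrite divr_ge0.
apply/eqP; rewrite -subr_eq0 -normr_le0; apply/ler_addgt0Pr => e e0; rewrite add0r.
(* [C] may be 0, hence [C + 1]. *)
have e'0 : 0 < e / (C + 1) by rewrite divr_gt0 // ltr_wpDl.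
have [w [w0 ws wp wq]] := kantorovich_coupling m0 us fp fq sp sq e'0.
rewrite K0 add0r => lte.
have -> : \sum_(x <- s) p x * F x - \sum_(x <- s) q x * F x =
    \sum_(x <- s) \sum_(y <- s) (F x - F y) * w x y.
  under [X in _ = X]eq_bigr do under eq_bigr do rewrite mulrBl.
  under [X in _ = X]eq_bigr do rewrite sumrB.
  rewrite sumrB; congr (_ - _).
    by apply: eq_bigr => x _; rewrite -mulr_sumr wp mulrC.
  rewrite exchange_big /=; apply: eq_bigr => x _.
  by rewrite -mulr_sumr wq mulrC.
apply: (@le_trans _ _ (C * cost m s w)).
  apply: (le_trans (ler_norm_sum _ _ _)); rewrite mulr_sumr big_seq [leRHS]big_seq.
  apply: ler_sum => x xs; apply: (le_trans (ler_norm_sum _ _ _)).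
  rewrite mulr_sumr big_seq [leRHS]big_seq; apply: ler_sum => y ys.
  by rewrite normrM (ger0_norm (w0 _ _)) mulrA ler_wpM2r // FC.
have cost0 : 0 <= cost m s w.
  by apply: sumr_ge0 => x _; apply: sumr_ge0 => y _; rewrite mulr_ge0.
apply: (@le_trans _ _ ((C + 1) * cost m s w)); first by rewrite ler_wpM2r // lerDl.
by rewrite mulrC -ler_pdivlMr ?ltW // ltr_wpDl.
Qed.

End Kantorovich.

(** * The universal chain and the bisimilarity distance *)

Section Extrema.
Variables (R : realType) (A B : Type).
Implicit Types (P : set (A -> B -> R)) (f : A -> B -> R).

Lemma leastE P f : is_least P f -> least P = f.
Proof.
move=> [Pf lf]; apply: xget_unique => // g [Pg lg].
by apply/funext => a; apply/funext => b; apply/eqP; rewrite eq_le lf // lg.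
Qed.

Lemma greatestE P f : is_greatest P f -> greatest P = f.
Proof.
move=> [Pf lf]; apply: xget_unique => // g [Pg lg].
by apply/funext => a; apply/funext => b; apply/eqP; rewrite eq_le lf // lg.
Qed.

End Extrema.

Section UniversalChain.
Variables (R : realType) (L X : countType).
Hypothesis infX : infinite_set [set: X]%classic.
Local Notation gterm := (term R L void X).
Local Notation obs := (L * gterm + X)%type.

Definition dirac (o o' : obs) : R := (o' == o)%:R.

Lemma indic_dirac (o o' : obs) : \1_([set o]%classic) o' = dirac o' o :> R.
Proof.
rewrite indicE /dirac; congr (_%:R); congr nat_of_bool.
by apply/idP/eqP; rewrite inE.
Qed.

Lemma chain_eqs_Ev : chain_eqs (fun (t : gterm) o => Ev t (dirac o)).
Proof.
split => // [t o|x|a t|x t].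
- rewrite Ev_ge0 ?Ev_le1 // => o'; rewrite /dirac ?ler0n // lern1.
  by case: eqP.
- by apply/funext => o; rewrite indic_dirac.
- by apply/funext => o; rewrite indic_dirac.
- apply/funext => o; rewrite -bind_inst1_close; exact: Ev_unfold.
Qed.

Lemma chain_eqs_unfold tau (b : term R L void (option X)) : chain_eqs tau ->
  tau (Mu b) = tau (bind (inst1 (Mu b)) b).
Proof.
case=> _ _ _ _ tau_mu; have [x bE] := Mu_mu infX b.
have := tau_mu x (rename (odflt x) b).
by rewrite -bind_inst1_close /mu -/(close x) -bE.
Qed.

(** Leastness of [Ev] among the solutions of [chain_eqs]. At a binder, the induction hypothesis is
    taken with the recursive term as the value of the bound name; it reads
    [loop b * y + Ev b g <= y], which is then solved for [y]. *)
Lemma chain_eqs_ge tau N (t : term R L void N) (r : N -> gterm) (o : obs) :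
  chain_eqs tau ->
  Ev t (fun o' => match o' with
                  | inl (a, u) => dirac o (inl (a, bind r u))
                  | inr x => tau (r x) o end) <= tau (bind r t) o.
Proof.
move=> ct; have [tau01 tauN tauP tauC _] := ct.
elim: t r => {N} [N []|N x|N a u IHu|N e u IHu w IHw|N b IHb] r.
- by [].
- by rewrite /= tauP indic_dirac.
- by rewrite /= tauC lerD ?ler_wpM2l ?subr_ge0.
- rewrite bind_Mu; set y := tau _ o.
  pose r' (z : option N) := if z is Some x then r x else Mu (bind (up r) b).
  have := IHb r'; rewrite -bind_inst1_up -(chain_eqs_unfold _ ct) -/y.
  rewrite Ev_Mu; set g := (X in _ -> _ * Ev b X <= _).
  have -> : Ev b (fun o' => match o' with
     | inl (a, u) => dirac o (inl (a, bind r' u)) | inr x => tau (r' x) o end) =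
     loop b * y + Ev b g.
    rewrite mulrC -EvZ -EvD; congr Ev; apply/funext => -[[a u]|[x|]] /=;
    rewrite ?mulr0 ?mulr1 ?add0r ?addr0 //.
    congr (dirac _ (inl (_, _))); rewrite bind_bind; congr bind.
    by apply/funext => -[].
  have /andP[y0 _] := tau01 (Mu (bind (up r) b)) o.
  (* For [loop b = 1] the inequality puts no constraint on [y]; the value 0 of [Ev] is below it
     because solutions are nonnegative. *)
  have [->|p_neq1] := eqVneq (loop b) 1; first by rewrite subrr invr0 mul0r.
  move=> ?; rewrite ler_pdivrMl; first by lra.
  by rewrite subr_gt0 lt_neqAle p_neq1 loop_le1.
Qed.

Lemma universal_chainE (t : gterm) o : universal_chain t o = Ev t (dirac o).
Proof.
rewrite /universal_chain (leastE (f := fun (t : gterm) o => Ev t (dirac o))) //.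
split; first exact: chain_eqs_Ev.
move=> tau ct {}t {}o; have := chain_eqs_ge t Name o ct; rewrite bind_Name.
apply: le_trans; rewrite le_eqVlt; apply/orP; left; apply/eqP.
have [_ tauN _ _ _] := ct.
congr Ev; apply/funext => -[[a u]|x]; first by rewrite bind_Name.
by rewrite tauN indic_dirac.
Qed.

Local Notation tau := (@universal_chain R L X).

(** The list of [Ev_sum] grouped by observation, so that the weights become the values of the
    chain. *)
Lemma Ev_seq (t : gterm) : exists2 s : seq obs, uniq s & covers s (tau t) /\
  forall f, Ev t f = \sum_(o <- s) tau t o * f o.
Proof.
have [l [E l0 l1]] := Ev_sum t; pose s := undup [seq z.2 | z <- l].
have us : uniq s := undup_uniq _.
have ls z : z \in l -> z.2 \in s by move=> zl; rewrite mem_undup map_f.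
exists s => //; split => [o|f].
  apply: contraR => os; rewrite universal_chainE E big_seq big1 // => z zl.
  rewrite /dirac; case: eqP => [zo|_]; last by rewrite mulr0.
  by rewrite -zo ls in os.
under eq_bigr => o _ do rewrite universal_chainE E mulr_suml.
rewrite exchange_big E big_seq [RHS]big_seq; apply: eq_bigr => z /ls zs /=.
rewrite -(sum_delta f us zs) mulr_sumr; apply: eq_bigr => o _.
by rewrite /dirac mulrA.
Qed.

Lemma star_bot (t : gterm) : star (tau t) None = 1 - Ev t (fun=> 1).
Proof.
have [s us [cs E]] := Ev_seq t; rewrite /= (fsum_seq us cs) E.
by congr (1 - _); apply: eq_bigr => o _; rewrite mulr1.
Qed.

Lemma star_seq (t : gterm) : exists2 s : seq (option obs), uniq s &
  covers s (star (tau t)) /\ forall F, \sum_(o <- s) star (tau t) o * F o =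
    Ev t (fun o => F (Some o)) + star (tau t) None * F None.
Proof.
have [s us [cs E]] := Ev_seq t; exists (None :: map Some s).
  rewrite /= map_inj_uniq ?us ?andbT; last by move=> ? ? [].
  by apply/mapP => -[].
split => [[o /cs os|_]|F].
- by rewrite inE map_f.
- exact: mem_head.
- by rewrite big_cons big_map E addrC.
Qed.

Lemma star_fdist (t : gterm) : is_fdist (star (tau t)).
Proof.
have [s us [cs E]] := star_seq t; apply: (fdistI us cs).
  move=> [o|]; first by rewrite /= universal_chainE Ev_ge0 // => ?; rewrite ler0n.
  by rewrite star_bot subr_ge0 Ev_le1.
under eq_bigr => o _ do rewrite -[star _ _]mulr1.
by rewrite (E (fun=> 1)) star_bot mulr1 subrKC.
Qed.

Lemma star_sum (t : gterm) s F : uniq s -> covers s (star (tau t)) ->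
  \sum_(o <- s) star (tau t) o * F o =
    Ev t (fun o => F (Some o)) + star (tau t) None * F None.
Proof.
move=> us cs; have [s' us' [cs' <-]] := star_seq t.
have cF s1 : covers s1 (star (tau t)) -> covers s1 (fun o => star (tau t) o * F o).
  by move=> c o h; apply: c; apply: contraNneq h => ->; rewrite mul0r.
by rewrite -(fsum_seq us) ?(fsum_seq us') //; apply: cF.
Qed.

Lemma eq_universal_chain (t s : gterm) : (forall f, Ev t f = Ev s f) -> tau t = tau s.
Proof. by move=> E; apply/funext => o; rewrite !universal_chainE E. Qed.

End UniversalChain.

(** * The distance as least fixed point of [Psi] *)

Section BisimilarityDistance.
Variables (R : realType) (L X : countType).
Hypothesis infX : infinite_set [set: X]%classic.
Local Notation gterm := (term R L void X).
Local Notation obs := (L * gterm + X)%type.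
Local Notation tau := (@universal_chain R L X).
Implicit Types (d : gterm -> gterm -> R) (t s u v : gterm).

(** The closed form of [lift_dist d]: distance 1 wherever nothing forces a smaller value. *)
Definition obs_dist d (x y : option obs) : R :=
  if x == y then 0 else
  match x, y with
  | Some (inl (a, t)), Some (inl (b, s)) => if a == b then d t s else 1
  | _, _ => 1
  end.

Lemma obs_dist_pref d a t s : d t t = 0 ->
  obs_dist d (Some (inl (a, t))) (Some (inl (a, s))) = d t s.
Proof. by rewrite /obs_dist eqxx; case: eqP => // -[->]. Qed.

Lemma obs_dist01 d x y : (forall t s, 0 <= d t s <= 1) -> 0 <= obs_dist d x y <= 1.
Proof.
move=> d01; rewrite /obs_dist; case: eqP => _; first by rewrite lexx ler01.
case: x y => [[[a t]|x]|] [[[b s]|y]|]; rewrite ?ler01 ?lexx //.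
by case: eqP => // _; rewrite ler01 lexx.
Qed.

Lemma pseudometric_obs_dist d : pseudometric1 d -> pseudometric1 (obs_dist d).
Proof.
move=> [d01 dxx dC dT]; split => [x y|x|x y|x y z].
- exact: obs_dist01.
- by rewrite /obs_dist eqxx.
- rewrite /obs_dist eq_sym; case: eqP => // _.
  by case: x y => [[[a t]|x]|] [[[b s]|y]|] //; rewrite eq_sym dC.
- have o0 x' y' : 0 <= obs_dist d x' y' by case/andP: (obs_dist01 x' y' d01).
  have o1 x' y' : obs_dist d x' y' <= 1 by case/andP: (obs_dist01 x' y' d01).
  have [<-|xy] := eqVneq x y; first by rewrite lerDr.
  have [<-|yz] := eqVneq y z; first by rewrite lerDl.
  (* A step of length 1 makes the inequality trivial; what remains are three prefixes with the same
     label. *)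
  have xfar : obs_dist d x y = 1 -> obs_dist d x z <= obs_dist d x y + obs_dist d y z.
    by move=> ->; rewrite ler_wpDr.
  have zfar : obs_dist d y z = 1 -> obs_dist d x z <= obs_dist d x y + obs_dist d y z.
    by move=> ->; rewrite ler_wpDl.
  case: x xy xfar zfar => [[[a t]|x]|] xy xfar zfar;
    try by apply: xfar; rewrite /obs_dist (negPf xy).
  case: y xy yz xfar zfar => [[[b s]|y]|] xy yz xfar zfar;
    try by apply: xfar; rewrite /obs_dist (negPf xy).
  case: z yz xfar zfar => [[[c u]|z]|] yz xfar zfar;
    try by apply: zfar; rewrite /obs_dist (negPf yz).
  have [ab|ab] := eqVneq a b; last first.
    by apply: xfar; rewrite /obs_dist (negPf xy) (negPf ab).
  have [bc|bc] := eqVneq b c; last first.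
    by apply: zfar; rewrite /obs_dist (negPf yz) (negPf bc).
  by subst b c; rewrite !obs_dist_pref.
Qed.

Lemma lift_distE d : pseudometric1 d -> lift_dist d = obs_dist d.
Proof.
move=> pd; have [_ dxx _ _] := pd; apply: greatestE; split.
  by split => [|a t s]; [exact: pseudometric_obs_dist|exact: obs_dist_pref].
move=> m [[m01 mxx _ _] mE] x y; rewrite /obs_dist.
case: eqP => [->|_]; first by rewrite mxx.
have m1 : m x y <= 1 by case/andP: (m01 x y).
case: x y m1 => [[[a t]|x]|] [[[b s]|y]|] //.
by case: eqP => // ->; rewrite mE.
Qed.

Lemma obs_dist_ge0 d x y : pseudometric1 d -> 0 <= obs_dist d x y.
Proof. by case=> d01 _ _ _; case/andP: (obs_dist01 x y d01). Qed.

Lemma PsiE d t s : pseudometric1 d ->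
  Psi d t s = kantorovich (obs_dist d) (star (tau t)) (star (tau s)).
Proof. by move=> pd; rewrite /Psi lift_distE. Qed.

Lemma pseudometric_Psi d : pseudometric1 d -> pseudometric1 (Psi d).
Proof.
move=> pd; have [o01 oxx oC oT] := pseudometric_obs_dist pd.
have o0 x y : 0 <= obs_dist d x y := obs_dist_ge0 x y pd.
have f := @star_fdist R L X infX.
split => [t s|t|t s|t u s]; rewrite !PsiE //.
- by rewrite kantorovich_ge0 // kantorovich_le1.
- exact: kantorovich_refl.
- by apply/eqP; rewrite eq_le !kantorovich_sym_le.
- exact: kantorovich_triangle.
Qed.

Lemma Psi_mono d d' t s : pseudometric1 d -> pseudometric1 d' ->
  (forall t s, d t s <= d' t s) -> Psi d t s <= Psi d' t s.
Proof.
move=> pd pd' dd; rewrite !PsiE //.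
have f := @star_fdist R L X infX; apply: kantorovich_mono => // x y.
  exact: obs_dist_ge0.
rewrite /obs_dist; case: eqP => // _.
by case: x y => [[[a u]|x]|] [[[b v]|y]|] //; case: eqP.
Qed.

Definition prefixed d : Prop := pseudometric1 d /\ forall t s, Psi d t s <= d t s.

(* Pointwise infima of pseudometrics need not satisfy the triangle inequality,
   so the infimum of the prefixed points is taken in the lattice of
   pseudometrics: as the supremum of the pseudometrics below them. *)
Definition below_prefixed : set (gterm -> gterm -> R) :=
  [set m | pseudometric1 m /\ forall g, prefixed g -> forall t s, m t s <= g t s]%classic.

Definition inf_prefixed t s : R := sup [set m t s | m in below_prefixed]%classic.

Lemma below_prefixed0 : below_prefixed (fun _ _ => 0).
Proof.
split; first by split => // *; rewrite ?lexx ?ler01 ?addr0.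
by move=> g [[g01 _ _ _] _] t s; case/andP: (g01 t s).
Qed.

Lemma le_inf_prefixed m t s : below_prefixed m -> m t s <= inf_prefixed t s.
Proof.
move=> bm; apply: ub_le_sup; last by exists m.
by exists 1 => _ [g [[g01 _ _ _] _] <-]; case/andP: (g01 t s).
Qed.

Lemma inf_prefixed_le t s c : (forall m, below_prefixed m -> m t s <= c) ->
  inf_prefixed t s <= c.
Proof.
move=> mc; apply: ge_sup; last by move=> _ [m bm <-]; apply: mc.
by exists 0; exists (fun _ _ => 0) => //; exact: below_prefixed0.
Qed.

Lemma pseudometric_inf_prefixed : pseudometric1 inf_prefixed.
Proof.
split => [t s|t|t s|t u s].
- rewrite (le_inf_prefixed t s below_prefixed0) inf_prefixed_le //.
  by move=> m [[m01 _ _ _] _]; case/andP: (m01 t s).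
- apply/eqP; rewrite eq_le (le_inf_prefixed t t below_prefixed0) andbT.
  by apply: inf_prefixed_le => m [[_ -> _ _] _].
- apply/eqP; rewrite eq_le; apply/andP; split; apply: inf_prefixed_le => m bm;
  by have [[_ _ -> _] _] := bm; apply: le_inf_prefixed.
- apply: inf_prefixed_le => m bm; have [[_ _ _ mT] _] := bm.
  by apply: (le_trans (mT _ u _)); rewrite lerD ?le_inf_prefixed.
Qed.

Lemma inf_prefixed_least g t s : prefixed g -> inf_prefixed t s <= g t s.
Proof. by move=> pg; apply: inf_prefixed_le => m [_]; apply. Qed.

(** Knaster-Tarski: by monotonicity [Psi inf_prefixed] is below every prefixed point, hence below
    [inf_prefixed], and it is then itself a prefixed point. *)
Lemma bisim_distE : @bisim_dist R L X = inf_prefixed.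
Proof.
have pI := pseudometric_inf_prefixed.
have PI t s : Psi inf_prefixed t s <= inf_prefixed t s.
  apply: le_inf_prefixed; split; first exact: pseudometric_Psi.
  move=> g pg t' s'; have [pmg Pg] := pg; apply: le_trans (Pg _ _).
  by apply: Psi_mono => // *; apply: inf_prefixed_least.
apply: leastE; split.
  split => //; apply/funext => t; apply/funext => s; apply/eqP.
  rewrite eq_le PI; apply: inf_prefixed_least; split.
    exact: pseudometric_Psi.
  by move=> t' s'; apply: Psi_mono => //; apply: pseudometric_Psi.
by move=> g [pg Pg] t s; apply: inf_prefixed_least; split => // *; rewrite Pg.
Qed.

Local Notation bd := (@bisim_dist R L X).

Lemma pseudometric_bisim : pseudometric1 bd.
Proof. by rewrite bisim_distE; exact: pseudometric_inf_prefixed. Qed.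

Lemma bisim_dist_le g t s : prefixed g -> bd t s <= g t s.
Proof. by rewrite bisim_distE; apply: inf_prefixed_least. Qed.

Lemma Psi_bisim : Psi bd = bd.
Proof.
have pb := pseudometric_bisim; have PB t s : Psi bd t s <= bd t s.
  rewrite {2}bisim_distE; apply: le_inf_prefixed; split; first exact: pseudometric_Psi.
  move=> g pg t' s'; have [pmg Pg] := pg; apply: le_trans (Pg _ _).
  by apply: Psi_mono => // *; apply: bisim_dist_le.
apply/funext => t; apply/funext => s; apply/eqP; rewrite eq_le PB /=.
apply: bisim_dist_le; split; first exact: pseudometric_Psi.
by move=> t' s'; apply: Psi_mono => //; apply: pseudometric_Psi.
Qed.

Lemma bisim_distK t s :
  bd t s = kantorovich (obs_dist bd) (star (tau t)) (star (tau s)).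
Proof. by rewrite -PsiE ?Psi_bisim //; exact: pseudometric_bisim. Qed.

Lemma bisim_dist_refl t : bd t t = 0.
Proof. by case: pseudometric_bisim. Qed.

Lemma bisim_dist_ge0 t s : 0 <= bd t s.
Proof. by case: pseudometric_bisim => b01 _ _ _; case/andP: (b01 t s). Qed.

Lemma bisim_dist_le1 t s : bd t s <= 1.
Proof. by case: pseudometric_bisim => b01 _ _ _; case/andP: (b01 t s). Qed.

Lemma bisim_distC t s : bd t s = bd s t.
Proof. by case: pseudometric_bisim. Qed.

Lemma bisim_distT u t s : bd t s <= bd t u + bd u s.
Proof. by case: pseudometric_bisim. Qed.

Lemma eq_Ev_bisim t s : (forall f, Ev t f = Ev s f) -> bd t s = 0.
Proof.
move=> /(eq_universal_chain infX) ts; rewrite bisim_distK ts -bisim_distK.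
exact: bisim_dist_refl.
Qed.

(** * Bisimilarity and bisimulation up to *)

Definition invariant (E : gterm -> gterm -> Prop) (f : obs -> R) : Prop :=
  forall a u v, E u v -> f (inl (a, u)) = f (inl (a, v)).

Definition sim t s : Prop := bd t s = 0.

Lemma sim_Ev t s f : sim t s -> invariant sim f -> Ev t f = Ev s f.
Proof.
rewrite /sim bisim_distK => K0 If; have f' := @star_fdist R L X infX.
have [l [ul lt ls]] := fdist_cover2 (f' t) (f' s).
(* The value 0 at bottom removes the contribution of the missing mass. *)
pose F (o : option obs) := oapp f 0 o.
have := kantorovich_eq0 (F := F) (fun x y => obs_dist_ge0 x y pseudometric_bisim)
  _ (f' t) (f' s) ul lt ls K0.
rewrite !(star_sum infX) //= !mulr0 !addr0; apply => x y.
rewrite /obs_dist; case: eqP => [->//|_].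
case: x y => [[[a u]|x]|] [[[b v]|y]|] /eqP; rewrite ?oner_eq0 //.
by case: (eqVneq a b) => [->|_]; [move=> /eqP; apply: If|rewrite oner_eq0].
Qed.

(** The pseudometric that is 0 on [E] and 1 elsewhere is a prefixed point of [Psi]: related terms
    give equal mass to each class of observations, so [kantorovich_equiv] applies. *)
Lemma equiv_bisim (E : gterm -> gterm -> Prop) :
  (forall t, E t t) -> (forall t s, E t s -> E s t) ->
  (forall t u s, E t u -> E u s -> E t s) ->
  (forall t s f, E t s -> invariant E f -> Ev t f = Ev s f) ->
  forall t s, E t s -> bd t s = 0.
Proof.
move=> Er Es Et EE t s Ets.
pose m u v : R := if `[< E u v >] then 0 else 1.
have pm : pseudometric1 m.
  split => [x y|x|x y|x y z]; rewrite /m.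
  - by case: asboolP; rewrite ?lexx ?ler01.
  - by case: asboolP => // -[].
  - by case: asboolP => xy; case: asboolP => // yx; [case: yx|case: xy]; apply: Es.
  - case: (asboolP (E x z)) => xz.
      by rewrite addr_ge0 //; case: ifP.
    case: (asboolP (E x y)) => xy; case: (asboolP (E y z)) => yz.
    + by case: xz; apply: Et xy yz.
    + by rewrite add0r.
    + by rewrite addr0.
    + by rewrite lerDl.
have o0 x y := obs_dist_ge0 x y pm.
have [_ oxx oC oT] := pseudometric_obs_dist pm.
have prem : prefixed m.
  split => // u v; have [Puv _ _ _] := pseudometric_Psi pm.
  rewrite {2}/m; case: asboolP => Euv; last by case/andP: (Puv u v).
  have f' := @star_fdist R L X infX.
  have [l [ul lu lv]] := fdist_cover2 (f' u) (f' v).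
  pose e x y := obs_dist m x y == 0.
  have o_eq x y z : e x y -> obs_dist m x z = obs_dist m y z.
    move=> /eqP exy; apply/eqP; rewrite eq_le.
    have := oT x y z; have := oT y x z; rewrite (oC y x) exy !add0r => -> ->.
    by [].
  rewrite PsiE // (kantorovich_equiv (e := e) o0 _ _ (f' u) (f' v) ul lu lv) //.
  - by move=> x y /eqP.
  - by move=> x y z; split; [rewrite /e oxx eqxx|move=> /o_eq o_xy; rewrite /e o_xy].
  (* The indicator of a class is an invariant function, and the mass at bottom is fixed by the
     expectation of the constant 1. *)
  - move=> x; rewrite !(star_sum infX) // !(star_bot infX).
    rewrite (EE u v (fun=> 1)) // (EE u v) // => a t' s' Ets' /=; congr (nat_of_bool _)%:R.
    rewrite /e !(oC x) (@o_eq _ (Some (inl (a, s')))) //.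
    by rewrite /e obs_dist_pref /m; [case: asboolP|case: asboolP (Er t')].
apply/eqP; rewrite eq_le bisim_dist_ge0 andbT.
by rewrite (le_trans (bisim_dist_le t s prem)) // /m; case: asboolP.
Qed.

(* Bisimulation up to the equivalence closure of Q and bisimilarity; that
   closure is represented by the functions that are constant on its classes. *)
Lemma bisim_upto (Q : gterm -> gterm -> Prop) :
  (forall t s f, Q t s -> invariant sim f -> invariant Q f -> Ev t f = Ev s f) ->
  forall t s, Q t s -> sim t s.
Proof.
move=> QE t s Qts.
pose E u v := forall g : gterm -> R,
  (forall x y, sim x y \/ Q x y -> g x = g y) -> g u = g v.
apply: (@equiv_bisim E) => //.
- by move=> x y Exy g /Exy.
- by move=> x y z Exy Eyz g gP; rewrite Exy // Eyz.
- move=> x y f Exy If; have Isim : invariant sim f.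
    by move=> a u v uv; apply: If => g; apply; left.
  have IQ : invariant Q f by move=> a u v uv; apply: If => g; apply; right.
  (* The map sending [u] to [Ev u f] agrees on the generating pairs, so [Exy] applies to it
     directly, without induction on chains of pairs. *)
  by apply: (Exy (fun u => Ev u f)) => u v [/sim_Ev|/QE]; apply.
- by move=> g; apply; right.
Qed.

(** * The distance under the term constructors *)

Lemma bisim_dist_pref a t s : bd (Pref a t) (Pref a s) <= bd t s.
Proof.
have starE u : star (tau (Pref a u)) = (fun o => (Some (inl (a, u)) == o)%:R).
  apply/funext => -[o|]; first by rewrite /= universal_chainE.
  by rewrite star_bot //= subrr.
rewrite bisim_distK !starE; apply: le_trans (kantorovich_dirac _ _ _) _.
  by move=> x y; apply: obs_dist_ge0 pseudometric_bisim.
by rewrite obs_dist_pref // bisim_dist_refl.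
Qed.

Lemma bisim_dist_choice (e : {i01 R}) t s t' s' :
  bd (Choice e t t') (Choice e s s') <= e%:num * bd t s + (1 - e%:num) * bd t' s'.
Proof.
have starE u v : star (tau (Choice e u v)) =
    (fun o => e%:num * star (tau u) o + (1 - e%:num) * star (tau v) o).
  apply/funext => -[o|]; first by rewrite /= !universal_chainE.
  by rewrite !star_bot //=; ring.
rewrite !bisim_distK !starE; have f' := @star_fdist R L X infX.
apply: kantorovich_convex => //; first by move=> x y; apply: obs_dist_ge0 pseudometric_bisim.
by apply/andP; split.
Qed.

Lemma sim_refl t : sim t t. Proof. exact: bisim_dist_refl. Qed.

Lemma sim_bind (r : X -> gterm) t s : sim t s -> sim (bind r t) (bind r s).
Proof.
move=> ts; apply: (bisim_upto (Q := fun x y =>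
  exists t s, [/\ sim t s, x = bind r t & y = bind r s])).
  move=> _ _ f [u [v [uv -> ->]]] Isim IQ; rewrite !Ev_bind; apply: (sim_Ev uv).
  by move=> a x y xy /=; apply: IQ; exists x, y.
by exists t, s.
Qed.

(** The common core of the recursion rules. The two instances of [u] part only where [x] is observed
    or inside a continuation; continuations are again such pairs, so one equation between [T] and
    [T'] remains. *)
Lemma sim_subst (x : X) (T T' : gterm) :
  (forall f, invariant sim f -> 
     (forall a u, f (inl (a, subst u T x)) = f (inl (a, subst u T' x))) ->
     Ev T f = Ev T' f) -> sim T T'.
Proof.
move=> TT'; apply: (bisim_upto (Q := fun v w =>
  exists u, v = subst u T x /\ w = subst u T' x)).
  move=> _ _ f [u [-> ->]] Isim IQ; rewrite /subst !Ev_bind; congr Ev.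
  have fQ a v : f (inl (a, subst v T x)) = f (inl (a, subst v T' x)).
    by apply: IQ; exists v.
  by apply/funext => -[[a v]|y] /=; [exact: fQ|case: eqP => // _; exact: TT'].
by exists (Name x); rewrite /subst /= eqxx.
Qed.

Lemma Ev_mu x t f : Ev (mu x t) f = (1 - Ev t (dirac (inr x)))^-1 *
  Ev t (fun o => match o with
    | inl (a, u) => f (inl (a, subst u (mu x t) x))
    | inr y => if y == x then 0 else f (inr y) end).
Proof.
rewrite Ev_Mu /loop !Ev_rename; congr (_^-1 * _).
  by congr (1 - Ev _ _); apply/funext => -[[]|y] //=; rewrite /dirac /=;
     case: (eqVneq y x) => [->|yx]; rewrite ?eqxx //; case: eqP => // -[yx'];
     rewrite yx' eqxx in yx.
congr Ev; apply/funext => -[[a u]|y] /=; last by case: eqP.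
by rewrite -bind_inst1_close.
Qed.

(** The binders differ in the body and in the term plugged into it: [sim_Ev] with [sim_bind]
    exchanges the body, [fQ] the plugged term. *)
Lemma sim_mu x t s : sim t s -> sim (mu x t) (mu x s).
Proof.
move=> ts; apply: (@sim_subst x) => f Isim fQ; rewrite !Ev_mu.
rewrite (sim_Ev (f := dirac (inr x)) ts) //; congr (_ * _).
rewrite (sim_Ev ts) => [|a u v uv].
  by congr Ev; apply/funext => -[[a u]|y] //; apply: fQ.
by apply: Isim; apply: sim_bind.
Qed.

(** The added summand only returns, so the factor [1 - p] and the escaping part are both scaled by
    [e], which cancels. *)
Lemma sim_unguard x (e : {i01 R}) t : e%:num != 0 ->
  sim (mu x (Choice e t (Name x))) (mu x t).
Proof.
move=> e0; apply: (@sim_subst x) => f Isim fQ; rewrite !Ev_mu /= eqxx mulr0 addr0.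
have -> : @dirac R L X (inr x) (inr x) = 1 by rewrite /dirac eqxx.
have -> : 1 - (e%:num * Ev t (dirac (inr x)) + (1 - e%:num) * 1) =
  e%:num * (1 - Ev t (dirac (inr x))) by ring.
rewrite invfM mulrACA mulVf // mul1r; congr (_ * _).
by congr Ev; apply/funext => -[[a u]|y] //; apply: fQ.
Qed.

(** After unfolding, both sides are [t] with a term plugged in for [x]. Continuations agree by [fQ],
    and guardedness excludes the observation of [x] itself. *)
Lemma sim_fix x t s : guarded x t -> sim s (subst t s x) -> sim s (mu x t).
Proof.
move=> gx ss; apply: (@sim_subst x) => f Isim fQ; rewrite (sim_Ev ss Isim).
rewrite Ev_unfold bind_inst1_close /subst !Ev_bind.
apply: (Ev_guarded gx) => -[[a u]|y] yx /=; first exact: fQ.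
by case: eqP => // yx'; case: yx; rewrite yx'.
Qed.

End BisimilarityDistance.

(** * Soundness *)

Section Instantiation.
Variables (R : realType) (L : Type).
Local Notation term := (@term R L).

Fixpoint inst (W V N : Type) (c : W -> term V void) (t : term W N) : term V N :=
  match t with
  | Meta v => rename (of_void N) (c v)
  | Name x => Name x
  | Pref a u => Pref a (inst c u)
  | Choice e u w => Choice e (inst c u) (inst c w)
  | Mu b => Mu (inst c b)
  end.

Lemma inst_rename W V N M (c : W -> term V void) (f : N -> M) (t : term W N) :
  inst c (rename f t) = rename f (inst c t).
Proof.
elim: t M f => {N} [N v|N x|N a u IHu|N e u IHu w IHw|N b IHb] M f //=.
- by rewrite rename_comp; apply: occurs_eq_rename => -[].
- by rewrite IHu.
- by rewrite IHu IHw.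
- by rewrite IHb.
Qed.

Lemma inst_bind W V N M (c : W -> term V void) (f : N -> term W M) (t : term W N) :
  inst c (bind f t) = bind (fun x => inst c (f x)) (inst c t).
Proof.
elim: t M f => {N} [N v|N x|N a u IHu|N e u IHu w IHw|N b IHb] M f //=.
- by rewrite bind_rename rename_bindE; congr bind; apply/funext => -[].
- by rewrite IHu.
- by rewrite IHu IHw.
- rewrite IHb; congr (Mu (bind _ _)); apply/funext => -[x|] //=.
  by rewrite inst_rename.
Qed.

(** The composition law behind (Subst): an instance of a substituted equation is an instance of the
    original one. *)
Lemma inst_inst W V U N (c : W -> term V void) (c' : V -> term U void) (t : term W N) :
  inst c' (inst c t) = inst (fun v => inst c' (c v)) t.
Proof.
elim: t => {N} [N v|N x|N a u IHu|N e u IHu w IHw|N b IHb] //=.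
- by rewrite inst_rename.
- by rewrite IHu.
- by rewrite IHu IHw.
- by rewrite IHb.
Qed.

Lemma inst_embed W N (c : W -> term void void) (t : term void N) :
  inst c (embed W t) = t.
Proof.
elim: t => {N} [N []|N x|N a u IHu|N e u IHu w IHw|N b IHb] //=.
- by rewrite IHu.
- by rewrite IHu IHw.
- by rewrite IHb.
Qed.

Lemma guarded_rename V N M (f : N -> M) (t : term V N) (x : M) :
  (forall y, f y <> x) -> guarded x (rename f t).
Proof.
elim: t M f x => {N} [N v|N y|N a u IHu|N e u IHu w IHw|N b IHb] M f x fx //=.
- by split; right; [apply: IHu|apply: IHw].
- by apply: IHb => -[y|] //= [/fx].
Qed.

Lemma guarded_inst W V N (c : W -> term V void) (t : term W N) (x : N) :
  guarded x t -> guarded x (inst c t).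
Proof.
elim: t x => {N} [N v|N y|N a u IHu|N e u IHu w IHw|N b IHb] x //=.
- by move=> _; apply: guarded_rename => -[].
- by move=> [gu gw]; split; [case: gu => [|/IHu]|case: gw => [|/IHw]]; by [left|right].
- exact: IHb.
Qed.

Section Names.
Variables (W V : Type) (X : eqType).

Lemma inst_mu (c : W -> term V void) x (t : term W X) :
  inst c (mu x t) = mu x (inst c t).
Proof. by rewrite /mu /= inst_rename. Qed.

Lemma inst_subst (c : W -> term V void) (t s : term W X) x :
  inst c (subst t s x) = subst (inst c t) (inst c s) x.
Proof.
by rewrite /subst inst_bind; congr bind; apply/funext => y; case: eqP.
Qed.

End Names.

(** The induction measure for [hom_extension_inst], where the body of a binder is renamed before the
    induction hypothesis is applied. *)
Fixpoint height (V N : Type) (t : term V N) : nat :=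
  match t with
  | Meta _ | Name _ => 0
  | Pref _ u => (height u).+1
  | Choice _ u w => (height u + height w).+1
  | Mu b => (height b).+1
  end.

Lemma height_rename V N M (f : N -> M) (t : term V N) :
  height (rename f t) = height t.
Proof.
elim: t M f => {N} [N v|N x|N a u IHu|N e u IHu w IHw|N b IHb] M f //=.
- by rewrite IHu.
- by rewrite IHu IHw.
- by rewrite IHb.
Qed.

End Instantiation.

(** * Interpretation of derivations *)

Section Soundness.
Variables (R : realType) (L X W : countType).
Hypothesis infX : infinite_set [set: X]%classic.
Local Notation mterm := (term R L W X).
Local Notation bd := (@bisim_dist R L X).

(** Since [mu x (Meta v)] does not depend on [x], neither does [mu x (sigma v)], and [closed_of_mu]
    makes [sigma v] closed. *)
Lemma hom_extension_inst (sigma : W -> mterm) h : hom_extension sigma h ->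
  exists c : W -> term R L W void, h = inst c.
Proof.
move=> [hMeta hName hPref hChoice hMu].
have /choice[c cE] v : exists c : term R L W void, sigma v = rename (of_void X) c.
  by apply: (closed_of_mu infX) => x y; rewrite -!hMeta -!hMu.
exists c; apply/funext => t; have [n] := ubnP (height t).
elim: n t => // n IH [v|x|a u|e u w|b] /= lt.
- by rewrite hMeta cE.
- by rewrite hName.
- by rewrite hPref IH.
- by rewrite hChoice !IH //; lia.
- have [x bE] := Mu_mu infX b.
  have -> : Mu b = mu x (rename (odflt x) b) by rewrite /mu -/(close x) -bE.
  by rewrite hMu IH ?height_rename // -inst_mu /mu -/(close x) -bE.
Qed.

Definition satisfies (c : W -> term R L void void) (phi : qeq R L X W) : Prop :=
  bd (inst c (lhs phi)) (inst c (rhs phi)) <= ratr (tol phi)%:num.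

Lemma satisfies_0 c t s :
  satisfies c (QEq t s 0%:nng) <-> sim (inst c t) (inst c s).
Proof.
rewrite /satisfies /= rmorph0; split => [le0|->//].
by apply/eqP; rewrite eq_le le0 bisim_dist_ge0.
Qed.

Lemma derivable_sound Gamma (phi : qeq R L X W) : derivable Gamma phi ->
  forall c, (forall psi, Gamma psi -> satisfies c psi) -> satisfies c phi.
Proof.
elim=> {Gamma phi}.
- by move=> t c _; apply/satisfies_0; apply: sim_refl.
- move=> t s eps c /(_ _ erefl); rewrite /satisfies /=.
  by rewrite bisim_distC.
- move=> t u s eps eps' c G.
  have := G _ (or_introl erefl); have := G _ (or_intror erefl).
  rewrite /satisfies /= rmorphD => us tu.
  by apply: (le_trans (bisim_distT infX (inst c u) _ _)); rewrite lerD.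
- move=> t s eps eps' _ c /(_ _ erefl); rewrite /satisfies /= rmorphD => ts.
  by apply: (le_trans ts); rewrite lerDl ler0q.
- move=> t s eps c G; rewrite /satisfies /= leNgt; apply/negP => lt.
  (* A rational tolerance strictly between [eps] and the distance contradicts the hypothesis at that
     tolerance. *)
  have [q] := rat_in_itvoo lt; rewrite in_itv /= => /andP[eq qd].
  have q0 : 0 <= q.
    by rewrite -(ler0q R) (le_trans _ (ltW eq)) // ler0q.
  suff : satisfies c (QEq t s (NngNum q0)) by rewrite /satisfies /= leNgt qd.
  by apply: G; exists (NngNum q0) => //=; rewrite -(ltr_rat R).
- move=> Gamma phi sigma h /hom_extension_inst [d ->] _ IH c G.
  have := IH (fun v => inst c (d v)); rewrite /satisfies /= -!inst_inst; apply.
  move=> psi Gpsi; have := G (map_qeq (inst d) psi); rewrite /satisfies /= !inst_inst.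
  by apply; exists psi.
- by move=> Gamma Theta phi _ IHT _ IH c G; apply: IH => psi /IHT; apply.
- by move=> Gamma phi Gphi c; apply.
- move=> t s c _; apply/satisfies_0/(eq_Ev_bisim infX) => f /=.
  by rewrite subrr mul1r mul0r addr0.
- move=> e t c _; apply/satisfies_0/(eq_Ev_bisim infX) => f /=.
  by ring.
- move=> e t s c _; apply/satisfies_0/(eq_Ev_bisim infX) => f /=.
  by ring.
- move=> e e' e'' t s u e1 e'1 eE c _; apply/satisfies_0/(eq_Ev_bisim infX) => f /=.
  rewrite eE; have ne0 : 1 - e%:num * e'%:num != 0.
    by rewrite subr_eq0 gt_eqF // mulr_ilt1.
  by field.
- move=> x t c _; apply/satisfies_0/(eq_Ev_bisim infX) => f.
  by rewrite inst_subst inst_mu -bind_inst1_close -Ev_unfold.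
- move=> x e t e0 c _; apply/satisfies_0; rewrite !inst_mu.
  exact: sim_unguard.
- move=> x t s gx c /(_ _ erefl) /satisfies_0; rewrite inst_subst => ss.
  apply/satisfies_0; rewrite inst_mu; apply: sim_fix => //.
  exact: guarded_inst.
- move=> x t s c /(_ _ erefl) /satisfies_0 ts.
  by apply/satisfies_0; rewrite !inst_mu; apply: sim_mu.
- move=> t s c _; rewrite /satisfies /= rmorph1; exact: bisim_dist_le1.
- move=> a t s eps c /(_ _ erefl); apply: le_trans; exact: bisim_dist_pref.
- move=> e t s t' s' eps eps' eps'' le_eps c G.
  have := G _ (or_introl erefl); have := G _ (or_intror erefl).
  rewrite /satisfies /= => ts' ts; apply: le_trans le_eps.
  apply: (le_trans (bisim_dist_choice infX _ _ _ _ _)).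
  by rewrite lerD // ler_wpM2l // subr_ge0.
Qed.

End Soundness.

Theorem theorem5p13 (R : realType) (L X W : countType)
    (infX : infinite_set [set: X]%classic)
    (t s : term R L void X) (eps : {nonneg rat}%R) :
  derivable (@set0 (qeq R L X W)) (QEq (embed W t) (embed W s) eps) ->
  (bisim_dist t s <= ratr eps%:num)%R.
Proof.
(* Any closed instantiation would do, as embedded terms contain no metavariable; the diverging term
   [Mu (Name None)] is a closed term that needs no label. *)
move=> /(derivable_sound infX) /(_ (fun=> Mu (Name None))).
by rewrite /satisfies /= !inst_embed; apply.
Qed.
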